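(* Let $n\ge1$ and suppose that $a_1,\dots,a_n$ are trigonometric polynomials. Then the monodromy $\widetilde\rho_n$ of the equation $$F'(x)=\Big(\sum_{i=1}^{n}a_i(x)t^iX_1X_2^{i-1}\Big)F(x)$$ is trivial if and only if there are a trigonometric polynomial $q$ and polynomials $p_1,\dots,p_n\in\mathbb{C}[z]$ such that $$\widetilde a_i(x)=p_i(q(x)),\qquad x\in S^1,\ 1\le i\le n,$$ where $\widetilde a_i(x)=\int_0^x a_i(s)\,ds$.
   Context: Functions on the circle $S^1$ are identified with $2\pi$-periodic functions on $\mathbb{R}$. Trigonometric polynomials are finite sums $\sum_k c_ke^{ikx}$, $c_k\in\mathbb{C}$. $\mathcal{A}(X_1,X_2)$ is the unital associative algebra (unit $I$) of polynomials with complex coefficients in free non-commutative variables $X_1,X_2$; $\mathcal{A}(X_1,X_2)[[t]]$ is the algebra of formal power series in $t$ over it and $G(X_1,X_2)[[t]]$ is its group of invertible elements. The equation has a fundamental solution $F:\mathbb{R}\to G(X_1,X_2)[[t]]$ with $F(0)=I$ given by Picard iteration, $F(x)=I+\sum_{k\ge1}\int_{0\le s_1\le\cdots\le s_k\le x}\omega_n(s_k)\cdots\omega_n(s_1)\,ds_k\cdots ds_1$, $\omega_n=\sum_{i=1}^n a_it^iX_1X_2^{i-1}$. The monodromy is the homomorphism $\widetilde\rho_n:\mathbb{Z}\to G(X_1,X_2)[[t]]$, $\widetilde\rho_n(m)=F(2\pi m)=F(2\pi)^m$; it is trivial iff $F(2\pi)=I$. *)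

(* Defs.v *)
From HB Require Import structures.
From mathcomp Require Import all_boot all_order all_algebra.
From mathcomp Require Import finmap complex ring.
From mathcomp Require Import all_classical all_reals all_analysis.
(* The notations of monalg clash with those of mathcomp-analysis. *)
From mathcomp Require Import -(notations) monalg.

Set Implicit Arguments.
Unset Strict Implicit.
Unset Printing Implicit Defensive.

Import Order.TTheory GRing.Theory Num.Theory numFieldNormedType.Exports.

Local Open Scope classical_set_scope.
Local Open Scope ring_scope.
Local Open Scope complex_scope.

Record fps (A : nzRingType) := Fps { fcoef : nat -> A }.
Arguments Fps {A}.
Arguments fcoef {A}.

Notation "f .[t^ n ]" := (fcoef f n) (at level 2, format "f .[t^ n ]").

Section FpsRing.
Variable A : nzRingType.
Implicit Types f g h : fps A.

Lemma fpsP f g : (forall n, f.[t^n] = g.[t^n]) -> f = g.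
Proof. by case: f g => f [g] /= fg; congr Fps; apply/funext. Qed.

HB.instance Definition _ := gen_eqMixin (fps A).
HB.instance Definition _ := gen_choiceMixin (fps A).

Definition fps0 : fps A := Fps (fun=> 0).
Definition fpsN f := Fps (fun n => - f.[t^n]).
Definition fpsD f g := Fps (fun n => f.[t^n] + g.[t^n]).
Definition fps1 : fps A := Fps (fun n => (n == 0%N)%:R).
Definition fpsM f g := Fps (fun n => \sum_(i < n.+1) f.[t^i] * g.[t^(n - i)]).

Fact fpsDA : associative fpsD.
Proof. by move=> f g h; apply: fpsP => n /=; rewrite addrA. Qed.
Fact fpsDC : commutative fpsD.
Proof. by move=> f g; apply: fpsP => n /=; rewrite addrC. Qed.
Fact fps0D : left_id fps0 fpsD.
Proof. by move=> f; apply: fpsP => n /=; rewrite add0r. Qed.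
Fact fpsND : left_inverse fps0 fpsN fpsD.
Proof. by move=> f; apply: fpsP => n /=; rewrite addNr. Qed.

HB.instance Definition _ :=
  GRing.isZmodule.Build (fps A) fpsDA fpsDC fps0D fpsND.

Lemma fpsM_rev f g n :
  (fpsM f g).[t^n] = \sum_(i < n.+1) f.[t^(n - i)] * g.[t^i].
Proof.
rewrite /= (reindex_inj rev_ord_inj) /=; apply: eq_bigr => i _.
by rewrite !subSS subKn // -ltnS.
Qed.

Fact fpsMA : associative fpsM.
Proof.
move=> f g h; apply: fpsP => n; rewrite [RHS]fpsM_rev /=.
pose coef3 j i := f.[t^j] * (g.[t^(n - j - i)] * h.[t^i]).
transitivity (\sum_(j < n.+1) \sum_(i < n.+1 | (i <= n - j)%N) coef3 j i).
  apply: eq_bigr => /= j _; transitivity (f.[t^j] * (fpsM g h).[t^(n - j)]) => //.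
  rewrite fpsM_rev big_distrr.
  rewrite (big_ord_narrow_leq (leq_subr _ _)).
  by [].
rewrite (exchange_big_dep predT) //=; apply: eq_bigr => i _.
transitivity (\sum_(j < n.+1 | (j <= n - i)%N) coef3 j i).
  apply: eq_bigl => j; rewrite -ltnS -(ltnS j) -!subSn ?leq_ord //.
  by rewrite -subn_gt0 -(subn_gt0 j) -!subnDA addnC.
rewrite (big_ord_narrow_leq (leq_subr _ _)) big_distrl.
by apply: eq_bigr => j _; rewrite /coef3 mulrA -!subnDA addnC.
Qed.

Fact fps1M : left_id fps1 fpsM.
Proof.
move=> f; apply: fpsP => n /=; rewrite big_ord_recl /= mul1r subn0 big1 ?addr0 //.
by move=> i _; rewrite mul0r.
Qed.
Fact fpsM1 : right_id fps1 fpsM.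
Proof.
move=> f; apply: fpsP => n; rewrite fpsM_rev big_ord_recl /= mulr1 subn0.
by rewrite big1 ?addr0 // => i _; rewrite mulr0.
Qed.
Fact fpsMDl : left_distributive fpsM fpsD.
Proof.
move=> f g h; apply: fpsP => n /=; rewrite -big_split /=.
by apply: eq_bigr => i _; rewrite mulrDl.
Qed.
Fact fpsMDr : right_distributive fpsM fpsD.
Proof.
move=> f g h; apply: fpsP => n /=; rewrite -big_split /=.
by apply: eq_bigr => i _; rewrite mulrDr.
Qed.
Fact fps1_neq0 : fps1 != 0 :> fps A.
Proof.
apply/eqP => /(congr1 (fun f : fps A => f.[t^0])) /= /eqP.
by rewrite oner_eq0.
Qed.

HB.instance Definition _ := GRing.Zmodule_isNzRing.Build (fps A)
  fpsMA fps1M fpsM1 fpsMDl fpsMDr fps1_neq0.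

Lemma fcoef0 n : (0 : fps A).[t^n] = 0. Proof. by []. Qed.
Lemma fcoefD f g n : (f + g).[t^n] = f.[t^n] + g.[t^n]. Proof. by []. Qed.
Lemma fcoefN f n : (- f).[t^n] = - f.[t^n]. Proof. by []. Qed.
Lemma fcoefB f g n : (f - g).[t^n] = f.[t^n] - g.[t^n]. Proof. by []. Qed.
Lemma fcoef1 n : (1 : fps A).[t^n] = (n == 0%N)%:R. Proof. by []. Qed.
Lemma fcoefM f g n :
  (f * g).[t^n] = \sum_(i < n.+1) f.[t^i] * g.[t^(n - i)].
Proof. by []. Qed.
Lemma fcoef_sum I (r : seq I) (P : pred I) (F : I -> fps A) n :
  (\sum_(i <- r | P i) F i).[t^n] = \sum_(i <- r | P i) (F i).[t^n].
Proof. by apply: (big_morph (fun f : fps A => f.[t^n])) => // f g. Qed.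

Definition fps_unit : pred (fps A) :=
  fun f => `[< exists g, g * f = 1 /\ f * g = 1 >].
Definition fps_inv f : fps A :=
  if pselect (exists g, g * f = 1 /\ f * g = 1) is left ex then projT1 (cid ex)
  else f.

Fact fps_mulVr : {in fps_unit, left_inverse 1 fps_inv *%R}.
Proof.
move=> f /asboolP uf; rewrite /fps_inv; case: pselect => // ex.
by case: cid => g [].
Qed.
Fact fps_divrr : {in fps_unit, right_inverse 1 fps_inv *%R}.
Proof.
move=> f /asboolP uf; rewrite /fps_inv; case: pselect => // ex.
by case: cid => g [].
Qed.
Fact fps_unitrP f g : g * f = 1 /\ f * g = 1 -> fps_unit f.
Proof. by move=> fg; apply/asboolP; exists g. Qed.
Fact fps_inv_out : {in [predC fps_unit], fps_inv =1 id}.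
Proof. by move=> f /asboolP nf; rewrite /fps_inv; case: pselect. Qed.

HB.instance Definition _ := GRing.NzRing_hasMulInverse.Build (fps A)
  fps_mulVr fps_divrr fps_unitrP fps_inv_out.

Definition tmonom (u : A) (d : nat) : fps A :=
  Fps (fun n => if n == d then u else 0).

Lemma fcoef_expr0 f k n : f.[t^0] = 0 -> (n < k)%N -> (f ^+ k).[t^n] = 0.
Proof.
move=> f0; elim: k n => // k IH n nk; rewrite exprS fcoefM big1 // => -[[|i] /= ilt] _.
  by rewrite f0 mul0r.
rewrite IH ?mulr0 //; apply: (@leq_trans n); last by rewrite -ltnS.
by rewrite ltn_subrL /=; case: (n) ilt.
Qed.

Lemma fps_unit1 f : f.[t^0] = 1 -> f \is a GRing.unit.
Proof.
move=> f0; pose u := 1 - f; pose gk k := \sum_(i < k) u ^+ i.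
pose g := Fps (fun n => (gk n.+1).[t^n]).
have u0 : u.[t^0] = 0 by rewrite /u fcoefB f0 subrr.
have gE k n : (n < k)%N -> g.[t^n] = (gk k).[t^n].
  elim: k => // k IH; rewrite ltnS leq_eqVlt => /predU1P[->//|nk].
  rewrite IH // (_ : gk k.+1 = gk k + u ^+ k); last exact: big_ord_recr.
  by rewrite fcoefD (fcoef_expr0 u0 nk) addr0.
have fE : f = 1 - u by rewrite /u opprB addrC subrK.
have fgk k : (1 - u) * gk k = 1 - u ^+ k by rewrite -opprB mulNr -subrX1 opprB.
have gkf k : gk k * (1 - u) = 1 - u ^+ k.
  rewrite -fgk /gk mulr_sumr mulr_suml; apply: eq_bigr => i _.
  by rewrite mulrBl mulrBr mul1r mulr1 -exprS -exprSr.
apply/unitrP; exists g; split; apply: fpsP => n.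
  transitivity (gk n.+1 * f).[t^n].
    by rewrite !fcoefM; apply: eq_bigr => i _; rewrite (gE n.+1).
  by rewrite fE gkf fcoefB (fcoef_expr0 u0) // subr0.
transitivity (f * gk n.+1).[t^n].
  rewrite !fcoefM; apply: eq_bigr => i _; rewrite (gE n.+1) //.
  by rewrite ltnS leq_subr.
by rewrite fE fgk fcoefB (fcoef_expr0 u0) // subr0.
Qed.

End FpsRing.

Section Trigonometric.
Variable R : realType.
Implicit Types (f g : R -> R) (F G : R -> R[i]).

Definition expi (x : R) : R[i] := cos x +i* sin x.

Definition trig_poly F : Prop :=
  exists s : seq (int * R[i]),
    forall x, F x = \sum_(kc <- s) kc.2 * expi (kc.1%:~R * x).

(* Oriented integral: the limits may come in either order. *)
Definition oint f (a b : R) : R :=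
  if a <= b then \int[@lebesgue_measure R]_(s in `[a, b]) f s
  else - \int[@lebesgue_measure R]_(s in `[b, a]) f s.

Definition cint F (a b : R) : R[i] :=
  oint (fun s => complex.Re (F s)) a b +i* oint (fun s => complex.Im (F s)) a b.

Definition ccont F : Prop :=
  continuous (fun s => complex.Re (F s)) /\
  continuous (fun s => complex.Im (F s)).

Definition cderiv F G : Prop :=
  forall x, is_derive x (1 : R) (fun s => complex.Re (F s)) (complex.Re (G x)) /\
            is_derive x (1 : R) (fun s => complex.Im (F s)) (complex.Im (G x)).

Lemma cont_integrable f (a b : R) : continuous f ->
  (@lebesgue_measure R).-integrable `[a, b] (EFin \o f).
Proof.
move=> cf; apply: continuous_compact_integrable; first exact: segment_compact.
exact: continuous_subspaceT.
Qed.

Lemma oint_sub f (c a b : R) : continuous f -> c <= a -> c <= b ->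
  oint f a b = \int[@lebesgue_measure R]_(s in `[c, b]) f s
             - \int[@lebesgue_measure R]_(s in `[c, a]) f s.
Proof.
move=> cf ca cb; rewrite /oint; case: ifPn => ab.
  rewrite (@Rintegral_itvB _ f (BLeft c) (BRight b) a) ?bnd_simp //.
    by rewrite Rintegral_itv_obnd_cbnd //; apply: integrableS (cont_integrable a b cf) => //;
       apply: subset_itvr; rewrite bnd_simp.
  exact: cont_integrable.
have ba : b <= a by rewrite ltW // ltNge.
rewrite -[RHS]opprB (@Rintegral_itvB _ f (BLeft c) (BRight a) b) ?bnd_simp //.
  by rewrite Rintegral_itv_obnd_cbnd //; apply: integrableS (cont_integrable b a cf) => //;
     apply: subset_itvr; rewrite bnd_simp.
exact: cont_integrable.
Qed.

Lemma oint_id f (a : R) : oint f a a = 0.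
Proof. by rewrite /oint lexx set_itv1 Rintegral_set1. Qed.

Lemma oint_derive f (a x : R) : continuous f -> is_derive x (1 : R) (oint f a) (f x).
Proof.
move=> cf; pose c := Num.min a x - 1; pose u := x + 1.
have ca : c <= a by rewrite lerBlDr ge_min lerDl ler01.
have cx : c < x by rewrite ltrBlDr gt_min orbC ltrDl ltr01.
have xu : x < u by rewrite ltrDl.
have [dF F'] := continuous_FTC1_closed xu (cont_integrable c u cf) cx (cf x).
pose H := (fun y => \int[@lebesgue_measure R]_(s in `[c, y]) f s)
          - cst (\int[@lebesgue_measure R]_(s in `[c, a]) f s).
have nH : {near x, H =1 oint f a}.
  near=> y; rewrite /H (@oint_sub f c a y) //; apply: ltW.
  by near: y; exact: lt_nbhsr.
apply: near_eq_is_derive nH _.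
rewrite -[f x]subr0; apply: is_deriveB.
apply: DeriveDef; first exact: dF.
by rewrite -derive1E; exact: F'.
Unshelve. all: by end_near. Qed.

Lemma oint_uniq f g (a b : R) : continuous f ->
  (forall x, is_derive x (1 : R) g (f x)) -> oint f a b = g b - g a.
Proof.
move=> cf dg; have : (oint f a - g) b = (oint f a - g) a.
  apply: is_derive_0_is_cst => x; rewrite -(subrr (f x)).
  by apply: is_deriveB; exact: oint_derive.
by rewrite !fctE oint_id sub0r => /eqP; rewrite subr_eq addrC => /eqP.
Qed.

Lemma cint_id F (a : R) : cint F a a = 0.
Proof. by rewrite /cint !oint_id. Qed.

Lemma cint_cderiv F (a : R) : ccont F -> cderiv (cint F a) F.
Proof. by move=> [cR cI] x; split; exact: oint_derive. Qed.

Lemma cint_uniq F G (a b : R) : ccont F -> cderiv G F -> cint F a b = G b - G a.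
Proof.
move=> [cR cI] dG; rewrite /cint.
rewrite (oint_uniq a b cR (fun x => (dG x).1)).
rewrite (oint_uniq a b cI (fun x => (dG x).2)).
by case: (G b) (G a) => [? ?] [? ?].
Qed.

Lemma cderiv_ccont F G : cderiv F G -> ccont F.
Proof.
move=> dF; split=> x; apply: differentiable_continuous; apply/derivable1_diffP.
  by have [[]] := dF x.
by have [_ []] := dF x.
Qed.

Lemma cderiv_cst (z : R[i]) : cderiv (fun=> z) (fun=> 0).
Proof. by move=> x; split; apply: is_derive_cst. Qed.

Lemma ReD (z w : R[i]) : complex.Re (z + w) = complex.Re z + complex.Re w.
Proof. by case: z w => [a b] [c d]. Qed.

Lemma ImD (z w : R[i]) : complex.Im (z + w) = complex.Im z + complex.Im w.
Proof. by case: z w => [a b] [c d]. Qed.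

Lemma cderivD F1 G1 F2 G2 : cderiv F1 G1 -> cderiv F2 G2 ->
  cderiv (fun x => F1 x + F2 x) (fun x => G1 x + G2 x).
Proof.
move=> d1 d2 x; have [r1 i1] := d1 x; have [r2 i2] := d2 x.
split.
  rewrite (_ : (fun s => _) = (fun s => complex.Re (F1 s)) + (fun s => complex.Re (F2 s))).
    by rewrite ReD; exact: is_deriveD.
  by apply/funext => s; rewrite fctE ReD.
rewrite (_ : (fun s => _) = (fun s => complex.Im (F1 s)) + (fun s => complex.Im (F2 s))).
  by rewrite ImD; exact: is_deriveD.
by apply/funext => s; rewrite fctE ImD.
Qed.

Lemma cderivB F1 G1 F2 G2 : cderiv F1 G1 -> cderiv F2 G2 ->
  cderiv (fun x => F1 x - F2 x) (fun x => G1 x - G2 x).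
Proof.
have ReB (u v : R[i]) : complex.Re (u - v) = complex.Re u - complex.Re v.
  by case: u v => [? ?] [? ?].
have ImB (u v : R[i]) : complex.Im (u - v) = complex.Im u - complex.Im v.
  by case: u v => [? ?] [? ?].
move=> d1 d2 x; have [r1 i1] := d1 x; have [r2 i2] := d2 x.
rewrite ReB ImB; split.
  rewrite (_ : (fun s => _) =
    (fun s => complex.Re (F1 s)) - (fun s => complex.Re (F2 s))).
    exact: is_deriveB.
  by apply/funext => s; rewrite ReB.
rewrite (_ : (fun s => _) =
  (fun s => complex.Im (F1 s)) - (fun s => complex.Im (F2 s))).
  exact: is_deriveB.
by apply/funext => s; rewrite ImB.
Qed.

Lemma ReM (z w : R[i]) :
  complex.Re (z * w) = complex.Re z * complex.Re w - complex.Im z * complex.Im w.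
Proof. by case: z w => [a b] [c d]. Qed.

Lemma ImM (z w : R[i]) :
  complex.Im (z * w) = complex.Re z * complex.Im w + complex.Im z * complex.Re w.
Proof. by case: z w => [a b] [c d]. Qed.

Lemma cderivM F1 G1 F2 G2 : cderiv F1 G1 -> cderiv F2 G2 ->
  cderiv (fun x => F1 x * F2 x) (fun x => G1 x * F2 x + F1 x * G2 x).
Proof.
move=> d1 d2 x; have [r1 i1] := d1 x; have [r2 i2] := d2 x.
split.
  rewrite (_ : (fun s => _) = (fun s => complex.Re (F1 s)) * (fun s => complex.Re (F2 s))
     - (fun s => complex.Im (F1 s)) * (fun s => complex.Im (F2 s))); last first.
    by apply/funext => s; rewrite !fctE ReM.
  apply: is_derive_eq; rewrite ReD !ReM /GRing.scale /=; ring.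
rewrite (_ : (fun s => _) = (fun s => complex.Re (F1 s)) * (fun s => complex.Im (F2 s))
   + (fun s => complex.Im (F1 s)) * (fun s => complex.Re (F2 s))); last first.
  by apply/funext => s; rewrite !fctE ImM.
apply: (is_derive_eq (is_deriveD (is_deriveM r1 i2) (is_deriveM i1 r2))).
rewrite ImD !ImM /GRing.scale /=.
ring.
Qed.

Lemma ccontD F G : ccont F -> ccont G -> ccont (fun x => F x + G x).
Proof.
move=> cF cG.
split=> x.
  under eq_fun do rewrite ReD.
  by apply: cvgD; [exact: cF.1|exact: cG.1].
under eq_fun do rewrite ImD.
by apply: cvgD; [exact: cF.2|exact: cG.2].
Qed.

Lemma ccontM F G : ccont F -> ccont G -> ccont (fun x => F x * G x).
Proof.
move=> [cFr cFi] [cGr cGi]; split=> x.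
  under eq_fun do rewrite ReM.
  by apply: cvgB; apply: cvgM; [exact: cFr|exact: cGr|exact: cFi|exact: cGi].
under eq_fun do rewrite ImM.
by apply: cvgD; apply: cvgM; [exact: cFr|exact: cGi|exact: cFi|exact: cGr].
Qed.

Lemma ccont_cst (z : R[i]) : ccont (fun=> z).
Proof. by split=> x; exact: cvg_cst. Qed.

Lemma expi_cont (k : R) : ccont (fun x => expi (k * x)).
Proof.
split=> x /=.
  apply: (@continuous_comp _ _ _ (fun s => k * s) cos); last exact: continuous_cos.
  exact: mulrl_continuous.
apply: (@continuous_comp _ _ _ (fun s => k * s) sin); last exact: continuous_sin.
exact: mulrl_continuous.
Qed.

Lemma trig_poly_cont F : trig_poly F -> ccont F.
Proof.
move=> [s Fs]; rewrite (_ : F = fun x => \sum_(kc <- s) kc.2 * expi (kc.1%:~R * x)).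
  elim: s {Fs} => [|kc s IH].
    by under eq_fun do rewrite big_nil; exact: ccont_cst.
  under eq_fun do rewrite big_cons; apply: ccontD => //.
  by apply: ccontM; [exact: ccont_cst|exact: expi_cont].
exact/funext.
Qed.

Lemma expi2pi (m : int) (x : R) : expi (m%:~R * (x + 2 * pi)) = expi (m%:~R * x).
Proof.
have H (n : nat) (y : R) : expi (y + n%:R * (2 * pi)) = expi y.
  elim: n => [|n IH]; first by rewrite mul0r addr0.
  rewrite -natr1 mulrDl mul1r addrA -[RHS]IH /expi.
  by rewrite (mulr_natl pi 2) cosD2pi sinD2pi.
case: m => n.
  by rewrite mulrDr H.
by rewrite -[LHS](H n.+1) NegzE mulrNz !mulNr mulrDr opprD subrK.
Qed.

Lemma trig_poly_periodic F : trig_poly F -> forall x, F (x + 2 * pi) = F x.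
Proof. by move=> [s Fs] x; rewrite !Fs; apply: eq_bigr => kc _; rewrite expi2pi. Qed.

End Trigonometric.

Lemma fpsM_sum (B : nzRingType) (o : fps B) (T : nat -> fps B) d :
  o.[t^0] = 0 -> (forall k e, (e < k)%N -> (T k).[t^e] = 0) ->
  (o * Fps (fun e => \sum_(k < e.+1) (T k).[t^e])).[t^d] =
  \sum_(k < d) (o * T k).[t^d].
Proof.
move=> o0 T0; rewrite fcoefM; under [RHS]eq_bigr do rewrite fcoefM.
rewrite exchange_big /=; apply: eq_bigr => -[[|i] /= ilt] _.
  by rewrite o0 mul0r big1 // => k _; rewrite mul0r.
rewrite -mulr_sumr; congr (_ * _).
have le : ((d - i.+1).+1 <= d)%N by rewrite ltn_subrL /=; case: (d) ilt.
rewrite (big_ord_widen _ (fun k => (T k).[t^(d - i.+1)]) le).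
rewrite [RHS](bigID (fun k : 'I_d => k < (d - i.+1).+1)%N) /=.
by rewrite [X in _ + X]big1 ?addr0 // => k; rewrite -leqNgt; exact: T0.
Qed.

Lemma malg_scalerAr (K : monomType) (C : comNzRingType) (c : C) (u v : malg K C) :
  u * (c *: v) = c *: (u * v).
Proof.
apply/malgP => w; rewrite mcoeffZ.
rewrite (mcoeffMlw w (fsubset_refl (msupp u)) (msuppZ_le c v)).
rewrite (mcoeffMlw w (fsubset_refl (msupp u)) (fsubset_refl (msupp v))).
rewrite mulr_sumr; apply: eq_bigr => i _.
rewrite mulr_sumr; apply: eq_bigr => j _.
by rewrite mcoeffZ mulrCA mulrnAr.
Qed.

Lemma malg_mulr_suml (K : monomType) (C : comNzRingType) (I : finType)
    (c : I -> C) (u : I -> malg K C) (v : malg K C) :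
  (\sum_i c i *: u i) * v = \sum_i c i *: (u i * v).
Proof. by rewrite mulr_suml; apply: eq_bigr => i _; rewrite scalerAl. Qed.

Section Monodromy.
Variable R : realType.

Local Notation A := (malg (fmonom 'I_2) R[i]).
Implicit Types (f g : R -> A) (w : fmonom 'I_2).

Definition X1 : A := mkmalgU (fmu (0 : 'I_2)) 1.
Definition X2 : A := mkmalgU (fmu (1 : 'I_2)) 1.

(* The element whose coefficients are the integrals of the coefficients of f;
   it exists at least when f takes its values in a fixed finite-dimensional
   subspace and is continuous (acont, aintE). *)
Definition aint f (x y : R) : A :=
  xget 0 [set u : A |
    forall w, mcoeff w u = cint (fun s => mcoeff w (f s)) x y].

Definition sint (f : R -> fps A) (x y : R) : fps A :=
  Fps (fun d => aint (fun s => (f s).[t^d]) x y).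

Section Equation.
Variables (n : nat) (a : 'I_n -> R -> R[i]).

(* a i stands for a_(i+1). *)
Definition omega (x : R) : fps A :=
  \sum_(i < n) tmonom (a i x *: (X1 * X2 ^+ i)) i.+1.

Fixpoint picard (k : nat) (x : R) : fps A :=
  if k is k'.+1 then sint (fun s => omega s * picard k' s) 0 x else 1.

(* The sum over k of picard k: as t ^ k divides picard k (picard_ord), only
   the terms k <= d contribute to the coefficient of t ^ d. *)
Definition fundsol (x : R) : fps A :=
  Fps (fun d => \sum_(k < d.+1) (picard k x).[t^d]).

Definition monodromy (m : int) : fps A := fundsol (2 * pi * m%:~R).

End Equation.

Definition aderiv f g : Prop :=
  forall w, cderiv (fun x => mcoeff w (f x)) (fun x => mcoeff w (g x)).

(* F' = omega F, coefficient by coefficient. *)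
Definition solution n (a : 'I_n -> R -> R[i]) (F : R -> fps A) : Prop :=
  forall d, aderiv (fun x => (F x).[t^d]) (fun x => (omega a x * F x).[t^d]).

Definition acont f : Prop :=
  exists (I : finType) (c : I -> R -> R[i]) (u : I -> A),
    (forall i, ccont (c i)) /\ forall x, f x = \sum_i c i x *: u i.

Lemma eq_cderiv (F1 F2 G1 G2 : R -> R[i]) :
  F1 =1 F2 -> G1 =1 G2 -> cderiv F2 G2 -> cderiv F1 G1.
Proof. by move=> /funext -> /funext ->. Qed.

Lemma eq_ccont (F1 F2 : R -> R[i]) : F1 =1 F2 -> ccont F2 -> ccont F1.
Proof. by move=> /funext ->. Qed.

Lemma eq_aderiv f1 f2 g1 g2 :
  f1 =1 f2 -> g1 =1 g2 -> aderiv f2 g2 -> aderiv f1 g1.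
Proof. by move=> /funext -> /funext ->. Qed.

Lemma eq_acont f1 f2 : f1 =1 f2 -> acont f2 -> acont f1.
Proof. by move=> /funext ->. Qed.

Lemma cderiv_sum (I : Type) (s : seq I) (F G : I -> R -> R[i]) :
  (forall i, cderiv (F i) (G i)) ->
  cderiv (fun x => \sum_(i <- s) F i x) (fun x => \sum_(i <- s) G i x).
Proof.
move=> dF; elim: s => [|i s IH].
  by apply: eq_cderiv (cderiv_cst 0) => x; rewrite big_nil.
by apply: eq_cderiv (cderivD (dF i) IH) => x; rewrite big_cons.
Qed.

Lemma cderivMr F G (z : R[i]) : @cderiv R F G ->
  cderiv (fun x => F x * z) (fun x => G x * z).
Proof.
move=> dF; by apply: eq_cderiv (cderivM dF (cderiv_cst z)) => x //; rewrite mulr0 addr0.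
Qed.

Lemma cint_lin (I : finType) (c : I -> R -> R[i]) (z : I -> R[i]) (x y : R) :
  (forall i, ccont (c i)) ->
  cint (fun s => \sum_i c i s * z i) x y = \sum_i cint (c i) x y * z i.
Proof.
move=> cc; pose G y := \sum_i cint (c i) x y * z i.
have dG : cderiv G (fun s => \sum_i c i s * z i).
  by apply: cderiv_sum => i; apply: cderivMr; exact: cint_cderiv.
have cG : ccont (fun s => \sum_i c i s * z i).
  elim: (index_enum I) => [|i s IH].
    by apply: eq_ccont (ccont_cst 0) => x'; rewrite big_nil.
  apply: eq_ccont (ccontD (ccontM (cc i) (ccont_cst (z i))) IH) => x'.
  by rewrite big_cons.
rewrite (cint_uniq x y cG dG) [G x]big1 ?subr0 // => i _.
by rewrite cint_id mul0r.
Qed.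

Lemma aintE (I : finType) (c : I -> R -> R[i]) (u : I -> A) f (x y : R) :
  (forall i, ccont (c i)) -> (forall s, f s = \sum_i c i s *: u i) ->
  aint f x y = \sum_i cint (c i) x y *: u i.
Proof.
move=> cc fE; pose v := \sum_i cint (c i) x y *: u i.
have vP w : mcoeff w v = cint (fun s => mcoeff w (f s)) x y.
  rewrite /v raddf_sum /=; under eq_bigr do rewrite mcoeffZ.
  rewrite -cint_lin //; congr cint; apply/funext => s.
  by rewrite fE raddf_sum /=; apply: eq_bigr => i _; rewrite mcoeffZ.
rewrite /aint; case: xgetP => [u' _ u'P|/(_ v)/(_ vP)//].
by apply/malgP => w; rewrite u'P -vP.
Qed.

Lemma aint_id f (x : R) : acont f -> aint f x x = 0.
Proof.
move=> [I [c [u [cc fE]]]]; rewrite (aintE _ _ cc fE) big1 // => i _.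
by rewrite cint_id scale0r.
Qed.

Lemma aint_aderiv f (x : R) : acont f -> aderiv (aint f x) f.
Proof.
move=> [I [c [u [cc fE]]]] w.
have -> : (fun y => mcoeff w (aint f x y)) = fun y => \sum_i cint (c i) x y * mcoeff w (u i).
  apply/funext => y; rewrite (aintE _ _ cc fE) raddf_sum /=.
  by apply: eq_bigr => i _; rewrite mcoeffZ.
have -> : (fun y => mcoeff w (f y)) = fun y => \sum_i c i y * mcoeff w (u i).
  apply/funext => y; rewrite fE raddf_sum /=.
  by apply: eq_bigr => i _; rewrite mcoeffZ.
by apply: cderiv_sum => i; apply: cderivMr; exact: cint_cderiv.
Qed.

Lemma acont_aint f (x : R) : acont f -> acont (aint f x).
Proof.
move=> [I [c [u [cc fE]]]]; exists I, (fun i => cint (c i) x), u; split.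
  by move=> i; apply: cderiv_ccont (cint_cderiv x (cc i)).
by move=> y; rewrite (aintE _ _ cc fE).
Qed.

Lemma acontZ (c : R -> R[i]) (u : A) : ccont c -> acont (fun x => c x *: u).
Proof.
move=> cc; exists unit, (fun=> c), (fun=> u); split=> // x.
by rewrite big_const card_unit /= addr0.
Qed.

Lemma acont_cst (u : A) : acont (fun=> u).
Proof.
by apply: eq_acont (acontZ u (ccont_cst (1 : R[i]))) => x; rewrite scale1r.
Qed.

Lemma acontD f g : acont f -> acont g -> acont (fun x => f x + g x).
Proof.
move=> [I [c [u [cc fE]]]] [J [d [v [cd gE]]]].
exists (I + J)%type, (fun k => match k with inl i => c i | inr j => d j end),
  (fun k => match k with inl i => u i | inr j => v j end); split.
  by case.
by move=> x; rewrite fE gE big_sumType.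
Qed.

Lemma acont_sum (I : Type) (s : seq I) (F : I -> R -> A) :
  (forall i, acont (F i)) -> acont (fun x => \sum_(i <- s) F i x).
Proof.
move=> cF; elim: s => [|i s IH].
  by apply: eq_acont (acont_cst 0) => x; rewrite big_nil.
by apply: eq_acont (acontD (cF i) IH) => x; rewrite big_cons.
Qed.

Lemma acontM f g : acont f -> acont g -> acont (fun x => f x * g x).
Proof.
move=> [I [c [u [cc fE]]]] [J [d [v [cd gE]]]].
exists (I * J)%type, (fun k x => c k.1 x * d k.2 x), (fun k => u k.1 * v k.2).
split=> [k|x]; first exact: ccontM.
rewrite fE gE mulr_suml; under eq_bigr do rewrite mulr_sumr.
rewrite pair_bigA /=; apply: eq_bigr => -[i j] _ /=.
by rewrite malg_scalerAr -scalerAl scalerA mulrC.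
Qed.

Lemma aintMr f (v : A) (x y : R) : acont f ->
  aint f x y * v = aint (fun s => f s * v) x y.
Proof.
move=> [I [c [u [cc fE]]]]; rewrite (aintE _ _ cc fE).
have fvE s : f s * v = \sum_i c i s *: (u i * v).
  by rewrite fE; exact: malg_mulr_suml.
rewrite (aintE x y cc fvE); exact: malg_mulr_suml.
Qed.

Lemma aderivD f1 g1 f2 g2 : aderiv f1 g1 -> aderiv f2 g2 ->
  aderiv (fun x => f1 x + f2 x) (fun x => g1 x + g2 x).
Proof.
by move=> d1 d2 w; apply: eq_cderiv (cderivD (d1 w) (d2 w)) => x; rewrite mcoeffD.
Qed.

Lemma aderivB f1 g1 f2 g2 : aderiv f1 g1 -> aderiv f2 g2 ->
  aderiv (fun x => f1 x - f2 x) (fun x => g1 x - g2 x).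
Proof.
by move=> d1 d2 w; apply: eq_cderiv (cderivB (d1 w) (d2 w)) => x; rewrite mcoeffB.
Qed.

Lemma aderiv_cst (u : A) : aderiv (fun=> u) (fun=> 0).
Proof.
move=> w; apply: eq_cderiv (cderiv_cst (mcoeff w u)) => x //.
exact: mcoeff0.
Qed.

Lemma aderiv_sum (I : Type) (s : seq I) (F G : I -> R -> A) :
  (forall i, aderiv (F i) (G i)) ->
  aderiv (fun x => \sum_(i <- s) F i x) (fun x => \sum_(i <- s) G i x).
Proof.
move=> dF; elim: s => [|i s IH].
  by apply: eq_aderiv (aderiv_cst 0) => x; rewrite big_nil.
by apply: eq_aderiv (aderivD (dF i) IH) => x; rewrite big_cons.
Qed.

Lemma aderiv0_cst f (x y : R) : aderiv f (fun=> 0) -> f x = f y.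
Proof.
move=> df; apply/malgP => w.
have c0 : ccont (fun=> mcoeff w (0 : A)) by exact: ccont_cst.
have := cint_uniq y x (ccont_cst (mcoeff w (0 : A))) (df w).
rewrite mcoeff0 (cint_uniq y x (ccont_cst 0) (cderiv_cst (0 : R[i]))) subrr.
by move/esym/eqP; rewrite subr_eq0 => /eqP.
Qed.

Lemma cderiv_shift (F G : R -> R[i]) (T : R) : cderiv F G ->
  cderiv (fun x => F (x + T)) (fun x => G (x + T)).
Proof.
move=> dF x; have [dr di] := dF (x + T).
split.
  have := @is_derive1_comp R (fun y => complex.Re (F y)) (shift T) x _ _ dr (is_derive_shift x 1 T).
  by rewrite mulr1.
have := @is_derive1_comp R (fun y => complex.Im (F y)) (shift T) x _ _ di (is_derive_shift x 1 T).
by rewrite mulr1.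
Qed.

Lemma omega_t0 n (a : 'I_n -> R -> R[i]) (x : R) : (omega a x).[t^0] = 0.
Proof. by rewrite fcoef_sum big1. Qed.

Lemma omega_acont n (a : 'I_n -> R -> R[i]) d : (forall i, ccont (a i)) ->
  acont (fun x => (omega a x).[t^d]).
Proof.
move=> ca; pose F i x := (tmonom (a i x *: (X1 * X2 ^+ i)) i.+1).[t^d].
suff cF i : acont (F i).
  by apply: eq_acont (acont_sum (index_enum 'I_n) cF) => x; rewrite fcoef_sum.
by rewrite /F /=; case: (d == _); [exact: acontZ|exact: acont_cst].
Qed.

Lemma picard_acont n (a : 'I_n -> R -> R[i]) k d : (forall i, ccont (a i)) ->
  acont (fun x => (picard a k x).[t^d]).
Proof.
move=> ca; elim: k d => [|k IH] d; first exact: acont_cst.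
apply: acont_aint; apply: acont_sum => i.
by apply: acontM; [exact: omega_acont|exact: IH].
Qed.

Lemma omegaM_acont n (a : 'I_n -> R -> R[i]) (F : R -> fps A) :
  (forall i, ccont (a i)) -> (forall d, acont (fun x => (F x).[t^d])) ->
  forall d, acont (fun x => (omega a x * F x).[t^d]).
Proof.
by move=> ca cF d; apply: acont_sum => i; apply: acontM => //; exact: omega_acont.
Qed.

Lemma aint_0 (x y : R) : aint (fun=> 0) x y = 0.
Proof.
rewrite (@aintE void (fun=> fun=> 0) (fun=> 0)); first by rewrite big1 // => -[].
  by case.
by move=> s; rewrite big1 // => -[].
Qed.

Lemma picard_ord n (a : 'I_n -> R -> R[i]) k d (x : R) :
  (d < k)%N -> (picard a k x).[t^d] = 0.
Proof.
elim: k d x => // k IH d x dk /=.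
rewrite (_ : (fun s => _) = fun=> 0) ?aint_0 //.
apply/funext => s; rewrite big1 // => -[[|i] /= ilt] _.
  by rewrite omega_t0 mul0r.
rewrite IH ?mulr0 //; apply: (@leq_trans d); last by rewrite -ltnS.
by rewrite ltn_subrL /=; case: (d) ilt.
Qed.

Lemma fundsol_acont n (a : 'I_n -> R -> R[i]) d : (forall i, ccont (a i)) ->
  acont (fun x => (fundsol a x).[t^d]).
Proof. by move=> ca; apply: acont_sum => k; exact: picard_acont. Qed.

Lemma omega_fundsol n (a : 'I_n -> R -> R[i]) d (x : R) :
  (omega a x * fundsol a x).[t^d] =
  \sum_(k < d) (omega a x * picard a k x).[t^d].
Proof.
apply: (fpsM_sum d (omega_t0 a x) (T := fun k => picard a k x)) => k e.
exact: picard_ord.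
Qed.

Lemma fundsol0 n (a : 'I_n -> R -> R[i]) : (forall i, ccont (a i)) ->
  fundsol a 0 = 1.
Proof.
move=> ca; apply: fpsP => d; rewrite [LHS]big_ord_recl /= big1 ?addr0 //.
move=> k _; apply: aint_id; apply: acont_sum => i.
by apply: acontM; [exact: omega_acont|exact: picard_acont].
Qed.

Lemma fundsol_solution n (a : 'I_n -> R -> R[i]) : (forall i, ccont (a i)) ->
  solution a (fundsol a).
Proof.
move=> ca d; apply: (@eq_aderiv _
  (fun x => (1 : fps A).[t^d] + \sum_(k < d) (picard a k.+1 x).[t^d])
  _ (fun x => 0 + \sum_(k < d) (omega a x * picard a k x).[t^d])).
- by move=> x; rewrite [LHS]big_ord_recl.
- by move=> x; rewrite [RHS]add0r; exact: omega_fundsol.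
apply: aderivD; first exact: aderiv_cst.
apply: aderiv_sum => k; apply: aint_aderiv; apply: omegaM_acont => // e.
exact: picard_acont.
Qed.

Lemma solution_eq0 n (a : 'I_n -> R -> R[i]) (F : R -> fps A) :
  solution a F -> F 0 = 0 -> forall x, F x = 0.
Proof.
move=> sF F0 x; apply: fpsP => d; elim/ltn_ind: d x => d IH x.
suff -> : (F x).[t^d] = (F 0).[t^d] by rewrite F0.
apply: (@aderiv0_cst (fun x => (F x).[t^d])).
apply: eq_aderiv (sF d) => // y; rewrite fcoefM big1 // => -[[|i] /= ilt] _.
  by rewrite omega_t0 mul0r.
by rewrite IH ?mulr0 // ltn_subrL /=; case: (d) ilt.
Qed.

Lemma solutionB n (a : 'I_n -> R -> R[i]) (F G : R -> fps A) :
  solution a F -> solution a G -> solution a (fun x => F x - G x).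
Proof.
move=> sF sG d; apply: eq_aderiv (aderivB (sF d) (sG d)) => x //.
by rewrite mulrBr.
Qed.

Lemma fundsol_unique n (a : 'I_n -> R -> R[i]) (F : R -> fps A) :
  (forall i, ccont (a i)) -> solution a F -> F 0 = 1 -> F = fundsol a.
Proof.
move=> ca sF F0; apply/funext => x; apply/eqP; rewrite -subr_eq0; apply/eqP.
apply: (@solution_eq0 _ a (fun x => F x - fundsol a x)).
  exact: (solutionB sF (fundsol_solution ca)).
by rewrite F0 fundsol0 // subrr.
Qed.

Lemma acont_mcoeff f w : acont f -> ccont (fun x => mcoeff w (f x)).
Proof.
move=> cf; have [I [c [u [cc fE]]]] := cf.
apply: (@eq_ccont _ (fun x => \sum_i c i x * mcoeff w (u i))) => [x|].
  by rewrite fE raddf_sum /=; apply: eq_bigr => i _; rewrite mcoeffZ.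
elim: (index_enum I) => [|i s IH].
  by apply: eq_ccont (ccont_cst 0) => x; rewrite big_nil.
apply: eq_ccont (ccontD (ccontM (cc i) (ccont_cst (mcoeff w (u i)))) IH) => x.
by rewrite big_cons.
Qed.

Lemma aderivE f g (x y : R) : acont g -> aderiv f g ->
  f y = f x + aint g x y.
Proof.
move=> cg df; apply/malgP => w; rewrite mcoeffD.
have cgw := acont_mcoeff w cg.
have := cint_uniq x y cgw (aint_aderiv x cg w).
rewrite (cint_uniq x y cgw (df w)) aint_id // mcoeff0 subr0 => <-.
by rewrite addrC subrK.
Qed.

Lemma aderivMr f g (v : A) : acont g -> aderiv f g ->
  aderiv (fun x => f x * v) (fun x => g x * v).
Proof.
move=> cg df; have cgv : acont (fun x => g x * v).
  by apply: acontM => //; exact: acont_cst.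
apply: eq_aderiv (aderivD (aderiv_cst (f 0 * v)) (aint_aderiv 0 cgv)) => x.
  by rewrite (aderivE 0 x cg df) mulrDl aintMr.
by rewrite add0r.
Qed.

Lemma solutionMr n (a : 'I_n -> R -> R[i]) (F : R -> fps A) (v : fps A) :
  (forall i, ccont (a i)) -> (forall d, acont (fun x => (F x).[t^d])) ->
  solution a F -> solution a (fun x => F x * v).
Proof.
move=> ca cF sF d.
pose G i x := (omega a x * F x).[t^i] * v.[t^(d - i)].
have dG : aderiv (fun x => \sum_(i < d.+1) (F x).[t^i] * v.[t^(d - i)])
    (fun x => \sum_(i < d.+1) G i x).
  by apply: aderiv_sum => i; apply: aderivMr => //; exact: omegaM_acont.
apply: (eq_aderiv (fun=> erefl) _ dG) => x.
exact: (congr1 (fun h : fps A => h.[t^d]) (mulrA (omega a x) (F x) v)).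
Qed.

Lemma solution_shift n (a : 'I_n -> R -> R[i]) (F : R -> fps A) (T : R) :
  (forall i y, a i (y + T) = a i y) -> solution a F ->
  solution a (fun x => F (x + T)).
Proof.
move=> aT sF d w.
have oT y : omega a (y + T) = omega a y by apply: eq_bigr => i _; rewrite aT.
have := cderiv_shift T (sF d w); apply: (eq_cderiv (fun=> erefl)) => y.
exact: (congr1 (fun o => mcoeff w (o * F (y + T)).[t^d]) (esym (oT y))).
Qed.

Lemma fundsolD n (a : 'I_n -> R -> R[i]) (x T : R) :
  (forall i, ccont (a i)) -> (forall i y, a i (y + T) = a i y) ->
  fundsol a (x + T) = fundsol a x * fundsol a T.
Proof.
move=> ca aT; apply/eqP; rewrite -subr_eq0; apply/eqP.
apply: (@solution_eq0 _ a (fun x => fundsol a (x + T) - fundsol a x * fundsol a T)).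
  apply: (solutionB (solution_shift aT (fundsol_solution ca))).
  apply: (solutionMr (fundsol a T) ca _ (fundsol_solution ca)) => d.
  exact: fundsol_acont.
by rewrite fundsol0 // add0r mul1r subrr.
Qed.

Lemma fundsol_unit n (a : 'I_n -> R -> R[i]) (x : R) :
  fundsol a x \is a GRing.unit.
Proof. by apply: fps_unit1; rewrite /= big_ord1. Qed.

Lemma trig_poly_periodic_int (F : R -> R[i]) (m : int) (x : R) :
  trig_poly F -> F (x + 2 * pi * m%:~R) = F x.
Proof.
move=> tF; have H (k : nat) y : F (y + 2 * pi * k%:R) = F y.
  elim: k => [|k IH]; first by rewrite mulr0 addr0.
  by rewrite -[k.+1%:R]natr1 mulrDr mulr1 addrA trig_poly_periodic.
case: m => k; first exact: H.
by rewrite -[LHS](H k.+1) NegzE mulrNz mulrN subrK.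
Qed.

Lemma monodromyD n (a : 'I_n -> R -> R[i]) (m p : int) :
  (forall i, trig_poly (a i)) ->
  monodromy a (m + p) = monodromy a m * monodromy a p.
Proof.
move=> ta; rewrite /monodromy intrD mulrDr fundsolD // => i.
  exact: trig_poly_cont.
by move=> y; exact: trig_poly_periodic_int.
Qed.

Lemma monodromyE n (a : 'I_n -> R -> R[i]) (m : int) :
  (forall i, trig_poly (a i)) -> monodromy a m = fundsol a (2 * pi) ^ m.
Proof.
move=> ta; have m0 : monodromy a 0 = 1.
  by rewrite /monodromy mulr0 fundsol0 // => i; exact: trig_poly_cont.
have m1 : monodromy a 1 = fundsol a (2 * pi) by rewrite /monodromy mulr1.
have mn (k : nat) : monodromy a k = fundsol a (2 * pi) ^+ k.
  elim: k => [|k IH]; first by rewrite m0 expr0.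
  by rewrite exprSr -IH -m1 -monodromyD // -[k.+1]addn1 PoszD.
case: m => k; first exact: mn.
have mk : monodromy a k.+1%:Z \is a GRing.unit by exact: fundsol_unit.
by rewrite /exprz -mn; apply: (mulIr mk); rewrite mulVr // -monodromyD // NegzE addNr.
Qed.

End Monodromy.

(* Main.v *)
Require Import Defs.
From mathcomp Require Import all_boot all_order all_algebra.
From mathcomp Require Import cyclic separable cyclotomic.
From mathcomp Require Import finmap complex ring zify.
From mathcomp Require Import all_classical all_reals all_analysis.
From mathcomp Require Import -(notations) monalg.

Import Order.TTheory GRing.Theory Num.Theory.

Local Open Scope ring_scope.
Local Open Scope complex_scope.

(* Indexing the a_i from 0, the coefficient in F(2 pi) of the word
   X1 X2^(i_k) ... X1 X2^(i_1) is the iterated integral of a_(i_1), ...,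
   a_(i_k), so the monodromy is trivial iff
   all iterated integrals vanish at 2 pi.  If each integral of a_i is p_i(q),
   every iterated integral is a polynomial in q minus its value at 0, and
   vanishes since q is periodic.

   Conversely, the span B of the iterated integrals is an algebra (integration
   by parts) of Laurent polynomials in z = exp(i x), and the constant term of
   f * z g' vanishes for all f, g in B.  If the elements of B have poles only
   at 0, or only at infinity, then q = 1/z, resp. q = z, works.  Otherwise the
   argument of Luroth's theorem gives q = u/v with q(Y) - q(z) dividing
   f(Y) - f(z) for all f in B.  As some g in B has poles at both 0 and infinity,
   one may take v = z^j, and either q has a pole at infinity, in which case B is
   contained in C[q] by interpolation, or q = z^(-j).  In the latter case B
   contains c z^(ji) for some c <> 0 and all i >= 0, and then some f in B makes
   the constant term of f * z g' nonzero. *)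

Set Implicit Arguments.
Unset Strict Implicit.
Unset Printing Implicit Defensive.

(** * Luroth's theorem for algebras of Laurent polynomials *)

Section Luroth.
Variable C : closedFieldType.
Implicit Types (h u v : {poly C}) (P Q S : {poly {poly C}}).

(* u(Y) v(z) - v(Y) u(z), where Y is the outer variable and z the inner one. *)
Definition cross u v : {poly {poly C}} := u^:P * v%:P - v^:P * u%:P.

Lemma coef_cross u v i : (cross u v)`_i = u`_i *: v - v`_i *: u.
Proof. by rewrite /cross coefB !coefMC !coef_map /= !mul_polyC. Qed.

Lemma swapXY_cross u v : swapXY (cross u v) = cross v u.
Proof.
apply/polyP => i; apply/polyP => j.
by rewrite coef_swapXY !coef_cross !coefB !coefZ ![v`_i * _]mulrC ![u`_i * _]mulrC.
Qed.

Lemma size_cross u v : (size (cross u v) <= maxn (size u) (size v))%N.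
Proof.
apply/leq_sizeP => j; rewrite geq_max => /andP[uj vj].
by rewrite coef_cross !nth_default // !scale0r subrr.
Qed.

Lemma horner_crossX u v : (cross u v).['X] = 0.
Proof.
by rewrite /cross !hornerE -!/(comp_poly _ _) !comp_polyXr mulrC subrr.
Qed.

Lemma horner_cross u v x : (cross u v).[x%:P] = u.[x] *: v - v.[x] *: u.
Proof. by rewrite /cross !hornerE !horner_map /= !mul_polyC. Qed.

Lemma eval_cross u v x :
  map_poly (horner_eval x) (cross u v) = v.[x] *: u - u.[x] *: v.
Proof.
apply/polyP => i; rewrite coef_map coef_cross /= /horner_eval !hornerE.
by rewrite coefB !coefZ !(mulrC (_`_i)).
Qed.

Definition lindep u v := v = 0 \/ exists l, u = l *: v.

Lemma cross_eq0 u v : cross u v = 0 -> lindep u v.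
Proof.
move=> c0; have [->|v0] := eqVneq v 0; first by left.
right; exists (u`_(size v).-1 / lead_coef v).
have /eqP := coef_cross u v (size v).-1.
rewrite c0 coef0 eq_sym subr_eq0 -lead_coefE => /eqP e.
by rewrite mulrC -scalerA e scalerA mulVf ?lead_coef_eq0 // scale1r.
Qed.

(** Gauss's lemma: the first hypothesis says that no X - x divides all coefficients of [P]. The
    roots x of [e] are peeled off one by one: modulo X - x the product [Q * P] vanishes and [P] does
    not, so [Q] does. *)
Lemma gauss_division (e : {poly C}) P Q S :
  (forall x, map_poly (horner_eval x) P != 0) -> e != 0 ->
  e *: S = Q * P -> exists Q', S = Q' * P.
Proof.
move=> Pprim; have [n] := ubnP (size e); elim: n e Q => // n IH e Q.
rewrite ltnS => le_e e0 eE.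
have [/eqP/size_poly1P[c c0 ec]|/closed_rootP[x /factor_theorem [e' ee']]] :=
    eqVneq (size e) 1%N.
  exists (c^-1%:P%:P * Q); rewrite -mulrA -eE ec -mul_polyC mulrA -!polyCM.
  by rewrite mulVf // mul1r.
have Qx : map_poly (horner_eval x) Q = 0.
  apply/eqP; have /eqP := congr1 (map_poly (horner_eval x)) eE.
  rewrite rmorphM /= -mul_polyC rmorphM /= map_polyC /= ee' /horner_eval.
  rewrite hornerM hornerXsubC subrr mulr0 mul0r eq_sym mulf_eq0.
  by rewrite (negPf (Pprim x)) orbF.
pose Q' := map_poly (fun q : {poly C} => q %/ ('X - x%:P)) Q.
have Q'E : Q = ('X - x%:P) *: Q'.
  apply/polyP => i; rewrite coefZ coef_map_id0 ?div0p // mulrC divpK //.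
  rewrite dvdp_XsubCl; apply/rootP.
  by have := congr1 (fun p : {poly C} => p`_i) Qx; rewrite coef_map coef0.
have e'0 : e' != 0 by apply: contraNneq e0 => z; rewrite ee' z mul0r.
apply: (IH e' Q') => //.
  by apply: leq_trans le_e; rewrite ee' size_Mmonic ?monicXsubC // size_XsubC addn2.
apply: (@mulfI _ ('X - x%:P)%:P); first by rewrite polyC_eq0 polyXsubC_eq0.
by rewrite mul_polyC scalerA -(mulrC e') -ee' eE Q'E -scalerAl -mul_polyC.
Qed.

End Luroth.

(** * Algebras of Laurent polynomials and the relations of z over them *)

Section LaurentAlgebra.
Variable C : closedFieldType.
Implicit Types (h u v : {poly C}) (P Q S : {poly {poly C}}).

(* [B N h] stands for: the Laurent polynomial h / X^N belongs to B. *)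
Record laurent_subalgebra (B : nat -> {poly C} -> Prop) : Prop := {
  lsubC : forall c, B 0%N c%:P;
  lsubD : forall N h k, B N h -> B N k -> B N (h + k);
  lsubM : forall N M h k, B N h -> B M k -> B (N + M)%N (h * k);
  lsubX : forall N h, B N.+1 ('X * h) <-> B N h }.

Variable B : nat -> {poly C} -> Prop.
Hypothesis algB : laurent_subalgebra B.

Lemma lsubZ N c h : B N h -> B N (c *: h).
Proof. by move=> Bh; rewrite -mul_polyC -[N]add0n; apply: lsubM => //; exact: lsubC. Qed.

Lemma lsubB N h k : B N h -> B N k -> B N (h - k).
Proof. by move=> Bh Bk; rewrite -scaleN1r; apply: lsubD => //; exact: lsubZ. Qed.

Lemma lsubXn k N h : B (k + N)%N ('X^k * h) <-> B N h.
Proof.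
elim: k => [|k IH]; first by rewrite mul1r.
by rewrite exprS -mulrA addSn lsubX.
Qed.

Lemma lsub0 N : B N 0.
Proof. by have := (lsubXn N 0 0).2 (lsubC algB 0); rewrite mulr0 addn0. Qed.

Lemma lsub_exp N h k : B N h -> B (N * k)%N (h ^+ k).
Proof.
move=> Bh; elim: k => [|k IH]; first by rewrite muln0; exact: lsubC.
by rewrite exprS mulnS; exact: lsubM.
Qed.

Lemma lsub_sum N (I : Type) (r : seq I) (F : I -> {poly C}) (p : pred I) :
  (forall i, p i -> B N (F i)) -> B N (\sum_(i <- r | p i) F i).
Proof. by move=> BF; elim/big_ind: _ => [|? ?|]; [exact: lsub0|exact: lsubD|]. Qed.

(* Up to the factor c(z), P(Y) has its coefficients in B, and it vanishes at
   Y = z: it is a polynomial relation satisfied by z over the fraction field of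
   B. *)
Definition lrel P : Prop := P.['X] = 0 /\
  exists N c, c != 0 /\ forall i, B N (c * P`_i).

Lemma lrel_reduce P S d : lrel P -> lrel S ->
  lrel (lead_coef P *: S - (lead_coef S *: 'X^d) * P).
Proof.
move=> [P0 [N [c [c0 BP]]]] [S0 [M [e [e0 BS]]]]; split.
  by rewrite hornerD hornerN hornerM hornerZ P0 S0 !mulr0 subrr.
exists (N + M)%N, (c * e); split=> [|i]; first by rewrite mulf_neq0.
rewrite coefB coefZ -scalerAl coefZ coefXnM mulrBr; apply: lsubB.
  by rewrite mulrACA; apply: (lsubM algB); [exact: BP|exact: BS].
rewrite [lead_coef S * _]mulrC mulrACA; apply: (lsubM algB); last exact: BS.
by case: ifP => _ //; rewrite mulr0; exact: lsub0.
Qed.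

Lemma size_lrel_reduce P S : P != 0 -> S != 0 -> (size P <= size S)%N ->
  (size (lead_coef P *: S -
         (lead_coef S *: 'X^(size S - size P)) * P)%R < size S)%N.
Proof.
rewrite -!size_poly_gt0 => P0 S0 PS; rewrite -[X in (_ < X)%N](prednK S0) ltnS.
apply/leq_sizeP => j.
rewrite coefB coefZ -scalerAl coefZ coefXnM leq_eqVlt => /orP[/eqP <-|lt_j].
  rewrite ifF; last by lia.
  rewrite (_ : (_ - _)%N = (size P).-1); last by lia.
  by rewrite -!lead_coefE mulrC subrr.
rewrite ifF; last by lia.
have SJ : (size S <= j)%N by lia.
rewrite (nth_default _ SJ) nth_default ?mulr0 ?subrr //.
by apply: leq_trans (leq_sub2r _ SJ); rewrite subKn.
Qed.

(** Pseudo-division by a relation of minimal degree in Y: a nonzero remainder is again a relation,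
    hence can be reduced further. *)
Lemma lrel_division P S : lrel P -> P != 0 ->
  (forall S', lrel S' -> S' != 0 -> (size P <= size S')%N) ->
  lrel S -> exists2 e, e != 0 & exists Q, e *: S = Q * P.
Proof.
move=> RP P0 minP; have [n] := ubnP (size S); elim: n S => // n IH S.
rewrite ltnS => leSn RS; have [->|S0] := eqVneq S 0.
  by exists 1; rewrite ?oner_eq0 //; exists 0; rewrite scaler0 mul0r.
have PS := minP _ RS S0.
have [e e0 [Q eQ]] :=
  IH _ (leq_trans (size_lrel_reduce P0 S0 PS) leSn) (lrel_reduce _ RP RS).
exists (e * lead_coef P); first by rewrite mulf_neq0 ?lead_coef_eq0.
exists (Q + e *: (lead_coef S *: 'X^(size S - size P))).
by rewrite mulrDl -eQ -[X in _ + X]scalerAl -scalerDr subrK scalerA.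
Qed.

(** Minimality in Y makes [P] divide every relation up to a factor e(z); minimality in z, imposed
    next, makes [P] primitive, so that Gauss's lemma removes e. *)
Lemma minimal_lrel P0 : lrel P0 -> P0 != 0 -> exists P,
  [/\ lrel P, P != 0, forall x, map_poly (horner_eval x) P != 0 &
  forall S, lrel S -> exists Q, S = Q * P].
Proof.
move=> RP0 nP0; pose isz n := `[< exists P, [/\ lrel P, P != 0 & size P = n] >].
have exz : exists n, isz n by exists (size P0); apply/asboolP; exists P0.
case: (ex_minnP exz) => _ /asboolP[P1 [RP1 nP1 <-]] min1.
pose isY n := `[< exists P, [/\ lrel P, P != 0, size P = size P1 & sizeY P = n] >].
have exY : exists n, isY n by exists (sizeY P1); apply/asboolP; exists P1.
case: (ex_minnP exY) => _ /asboolP[P [RP nP sP <-]] minY.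
(* A content X - x could be moved to the factor c of [lrel], decreasing sizeY. *)
have Pprim x : map_poly (horner_eval x) P != 0.
  apply/eqP => Px0.
  pose P' := map_poly (fun q : {poly C} => q %/ ('X - x%:P)) P.
  have P'E : P = ('X - x%:P)%:P * P'.
    apply/polyP => i; rewrite coefCM coef_map_id0 ?div0p // mulrC divpK //.
    rewrite dvdp_XsubCl; apply/rootP.
    by have := congr1 (fun p : {poly C} => p`_i) Px0; rewrite coef_map coef0.
  have nP' : P' != 0 by apply: contraNneq nP => z; rewrite P'E z mulr0.
  have X0 := polyXsubC_eq0 x.
  have sP' : size P' = size P by rewrite P'E size_Cmul // X0.
  have : (sizeY P <= sizeY P')%N.
    apply: minY; apply/asboolP; exists P'; split => //; last by rewrite sP'.
    case: RP => [P0x [N [c [c0 BP]]]]; split.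
      by move: P0x => /eqP; rewrite P'E hornerM hornerC mulf_eq0 X0 => /eqP.
    exists N, (c * ('X - x%:P)); split=> [|i]; first by rewrite mulf_neq0 ?X0.
    by move: (BP i); rewrite P'E coefCM mulrA.
  rewrite P'E !sizeYE rmorphM /= swapXY_polyC mulrC size_Mmonic.
  - by rewrite map_polyXsubC size_XsubC addn2 ltnn.
  - by rewrite swapXY_eq0.
  - by rewrite map_polyXsubC monicXsubC.
exists P; split => // S RS.
have [|e e0 [Q eQ]] := lrel_division RP nP _ RS.
  move=> S' RS' nS'; rewrite sP; apply: min1; apply/asboolP; by exists S'.
exact: gauss_division Pprim e0 eQ.
Qed.

Lemma lrel_cross N c u v : c != 0 -> B N (c * u) -> B N (c * v) -> lrel (cross u v).
Proof.
move=> c0 Bu Bv; split; first exact: horner_crossX.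
exists N, c; split=> // i; rewrite coef_cross mulrBr -!scalerAr.
by apply: lsubB; exact: lsubZ.
Qed.

Lemma lrel_cross_self M h : B M h -> lrel (cross h 'X^M).
Proof.
move=> Bh; apply: (@lrel_cross M 1); rewrite ?oner_eq0 ?mul1r //.
by have := (lsubXn M 0 1).2 (lsubC algB 1); rewrite addn0 mulr1.
Qed.

(** Otherwise P = v(z) L(Y) with L over [C], and P(z) = 0 forces L = 0. The coefficients found here
    have a nonconstant quotient. *)
Lemma lrel_lindep P : lrel P -> P != 0 -> exists i, ~ lindep P`_i (lead_coef P).
Proof.
move=> [P0 _] nP; apply/not_existsP => dep; set v := lead_coef P in dep.
have v0 : v != 0 by rewrite lead_coef_eq0.
pose k := (size v).-1; pose L := (lead_coef v)^-1 *: map_poly (coefp k) P.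
have PE : P = v *: L^:P.
  apply/polyP => i; rewrite coefZ coef_map coefZ coef_map /=.
  have /contrapT[z|[l ->]] := dep i; first by rewrite z eqxx in v0.
  rewrite coefZ -[v`_k]/(lead_coef v) mulrCA mulVf ?lead_coef_eq0 // mulr1.
  by rewrite mulrC mul_polyC.
have : v * L = 0 by rewrite -P0 PE hornerZ -/(comp_poly _ _) comp_polyXr.
move/eqP; rewrite mulf_eq0 (negPf v0) => /eqP z.
by rewrite PE z rmorph0 scaler0 eqxx in nP.
Qed.

(* The pair (u, v) has minimal size.  As cross u v = Q * P with P the minimal
   relation, comparing degrees in z shows that Q only depends on Y; a root of Q
   would be a common root of u and v. *)
Lemma luroth_pair M0 h0 : B M0 h0 -> ~ lindep h0 'X^M0 ->
  exists N c u v, [/\ c != 0, B N (c * u), B N (c * v) & ~ lindep u v] /\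
    (forall x, u.[x] = 0 -> v.[x] != 0) /\
    forall M h, B M h -> exists Q, cross h 'X^M = Q * cross u v.
Proof.
move=> Bh0 ih0.
have [|P [RP nP _ divP]] := minimal_lrel (lrel_cross_self Bh0).
  by apply/eqP => /cross_eq0.
pose pairs u v := ~ lindep u v /\ exists N c, [/\ c != 0, B N (c * u) & B N (c * v)].
pose isr r := `[< exists u v, pairs u v /\ maxn (size u) (size v) = r >].
have [i ii] := lrel_lindep RP nP.
have pP : pairs P`_i (lead_coef P).
  by split=> //; case: RP => _ [N [c [c0 BP]]]; exists N, c; split=> //; exact: BP.
have exr : exists n, isr n.
  exists (maxn (size P`_i) (size (lead_coef P))).
  by apply/asboolP; exists P`_i, (lead_coef P).
case: (ex_minnP exr) => r /asboolP[u [v [[iuv [N [c [c0 Bu Bv]]]] sr]]] minr.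
(* Two coefficients of [P] compete with (u, v), so the minimum r is at most the size of [P] in z. *)
have rP : (r <= sizeY P)%N.
  apply: leq_trans (minr _ _) _; first by apply/asboolP; exists P`_i, (lead_coef P).
  by rewrite geq_max max_size_coefXY max_size_lead_coefXY.
have uv0 : cross u v != 0 by apply/eqP => /cross_eq0.
have [Q QE] := divP _ (lrel_cross c0 Bu Bv).
have nQ : Q != 0 by apply: contraNneq uv0 => z; rewrite QE z mul0r.
(* A common factor X - x could be absorbed into c, leaving a smaller pair. *)
have no_common x : u.[x] = 0 -> v.[x] != 0.
  move=> /rootP/factor_theorem[u' uE]; apply/eqP => /rootP/factor_theorem[v' vE].
  have X0 := polyXsubC_eq0 x.
  have := iuv; rewrite uE vE => iuv'.
  have iuv1 : ~ lindep u' v'.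
    move=> [z|[l ul]]; apply: iuv'; [left|right]; first by rewrite z mul0r.
    by exists l; rewrite ul scalerAl.
  have p' : pairs u' v'.
    split=> //; exists N, (c * ('X - x%:P)); split; first by rewrite mulf_neq0 ?X0.
      by rewrite -mulrA -(mulrC u') -uE.
    by rewrite -mulrA -(mulrC v') -vE.
  have : (r <= maxn (size u') (size v'))%N.
    by apply: minr; apply/asboolP; exists u', v'.
  have v'0 : v' != 0 by apply/eqP => z; apply: iuv1; left.
  have u'0 : u' != 0.
    by apply/eqP => z; apply: iuv1; right; exists 0; rewrite scale0r.
  by rewrite -sr uE vE !size_Mmonic ?monicXsubC // size_XsubC !addn2 /= maxnSS ltnn.
have sQ : (size (swapXY Q) <= 1)%N.
  have : (size (swapXY (cross u v)) <= r)%N.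
    by rewrite swapXY_cross -sr maxnC size_cross.
  rewrite QE rmorphM size_mul ?swapXY_eq0 // -sizeYE -sizeYE.
  have : (0 < sizeY P)%N by rewrite lt0n sizeY_eq0.
  have : (0 < sizeY Q)%N by rewrite lt0n sizeY_eq0.
  move: rP; move: (sizeY Q) (sizeY P) => a b; lia.
have [k QkE] : exists k : {poly C}, Q = k^:P.
  by exists (swapXY Q)`_0; rewrite -swapXY_polyC -size1_polyC // swapXYK.
have /eqP/size_poly1P[k0 nk0 kE] : size k = 1%N.
  apply/eqP/negPn/negP => /closed_rootP[x /rootP kx].
  (* Setting Y = x at a root x of k gives u(x) v = v(x) u; as u and v are independent, both vanish
     at x. *)
  have := congr1 (fun S => S.[x%:P]) QE.
  rewrite QkE horner_cross hornerM horner_map /= kx mul0r => /eqP.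
  rewrite subr_eq0 => /eqP uv.
  have vx : v.[x] = 0.
    apply/eqP/negPn/negP => vx; apply: iuv; right; exists (u.[x] / v.[x]).
    by rewrite mulrC -scalerA uv scalerA mulVf // scale1r.
  have ux : u.[x] = 0.
    apply/eqP/negPn/negP => ux; apply: iuv; left; apply/eqP.
    by move/eqP: uv; rewrite vx scale0r scaler_eq0 (negPf ux).
  by have := no_common _ ux; rewrite vx eqxx.
exists N, c, u, v; split; first by split.
split=> // M h Bh; have [Q' ->] := divP _ (lrel_cross_self Bh).
exists (Q' * k0^-1%:P%:P); rewrite QE QkE kE map_polyC /= -mulrA; congr (_ * _).
by rewrite mulrA -!polyCM mulVf // mul1r.
Qed.

End LaurentAlgebra.

(** * Bilinearity of [cross], monomials and homogenization *)

Section CrossCalculus.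
Variable C : closedFieldType.
Implicit Types (h u v : {poly C}) (P Q S : {poly {poly C}}).

Lemma lindep_cross u v : lindep u v -> cross u v = 0.
Proof.
move=> dep; apply/polyP => i; rewrite coef_cross coef0.
case: dep => [->|[l ->]]; first by rewrite coef0 scale0r scaler0 subrr.
by rewrite coefZ scalerA mulrC subrr.
Qed.

Lemma cross_linr u v a b : cross u (a *: u + b *: v) = b%:P%:P * cross u v.
Proof.
apply/polyP => i; rewrite coefCM !coef_cross coefD !coefZ -!mul_polyC !polyCD !polyCM.
ring.
Qed.

Lemma cross_linl u v a b : cross (a *: u + b *: v) v = a%:P%:P * cross u v.
Proof.
apply/polyP => i; rewrite coefCM !coef_cross coefD !coefZ -!mul_polyC !polyCD !polyCM.
ring.
Qed.

Lemma crossC u v : cross v u = - cross u v.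
Proof. by rewrite /cross opprB. Qed.

Lemma monomial_of_roots (p : {poly C}) : p != 0 -> (forall y, root p y -> y = 0) ->
  exists k j, k != 0 /\ p = k *: 'X^j.
Proof.
move=> p0 rp; have [r pE] := closed_field_poly_normal p.
exists (lead_coef p), (size r); rewrite lead_coef_eq0; split=> //.
rewrite {1}pE big_seq (eq_bigr (fun=> 'X)) => [|z zr].
  by rewrite -big_seq big_const_seq count_predT -Monoid.iteropE.
have -> : z = 0; last by rewrite subr0.
by apply: rp; rewrite pE rootZ ?lead_coef_eq0 // root_prod_XsubC.
Qed.

Lemma monomial_dvdp (p : {poly C}) k N : k != 0 -> p %| k *: 'X^N ->
  exists l j, l != 0 /\ p = l *: 'X^j.
Proof.
move=> k0; rewrite dvdpZr // => pX.
apply: monomial_of_roots => [|y py].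
  by apply: contraTneq pX => ->; rewrite dvd0p -size_poly_eq0 size_polyXn.
have := root_dvdp pX py; rewrite /root hornerXn expf_eq0 => /andP[_ /eqP //].
Qed.

Lemma size_neq1_root (p : {poly C}) : (1 < size p)%N -> exists x, root p x.
Proof. by move=> p1; apply/closed_rootP; rewrite gtn_eqF. Qed.

(** X^(j k) p(u / X^j) with its denominators cleared, for p of degree at most k. *)
Definition homogenize (p u : {poly C}) (j k : nat) : {poly C} :=
  \sum_(l < k.+1) p`_l *: (u ^+ l * 'X^(j * (k - l))).

(** Modulo u - t X^j, each power u^l may be replaced by (t X^j)^l. *)
Lemma homogenize_mod (p u : {poly C}) j k t : (size p <= k.+1)%N ->
  u - t *: 'X^j %| p.[t] *: 'X^(j * k) - homogenize p u j k.
Proof.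
move=> sp; rewrite (horner_coef_wide _ sp) scaler_suml -sumrB.
elim/big_ind: _ => [|x y|l _]; [exact: dvdp0|exact: dvdp_add|].
rewrite -scalerA -scalerBr -[X in _ %| X]mul_polyC dvdp_mull //.
have -> : t ^+ l *: 'X^(j * k) - u ^+ l * 'X^(j * (k - l)) =
    ((t *: 'X^j) ^+ l - u ^+ l) * 'X^(j * (k - l)).
  rewrite mulrBl exprZn -exprM -scalerAl -exprD -mulnDr subnKC //.
  by rewrite -ltnS.
by apply: dvdp_mulr; rewrite -[X in _ %| X]opprB dvdpNr subrXX dvdp_mulIl.
Qed.

Lemma horner_homogenize (p u : {poly C}) j k z : (size p <= k.+1)%N -> z != 0 ->
  (homogenize p u j k).[z] = p.[u.[z] / z ^+ j] * z ^+ (j * k).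
Proof.
move=> sp z0; rewrite (horner_coef_wide _ sp) horner_sum mulr_suml.
apply: eq_bigr => l _; rewrite hornerZ hornerM horner_exp hornerXn -mulrA.
congr (_ * _); have lk : (l <= k)%N by rewrite -ltnS.
have -> : z ^+ (j * k) = z ^+ (j * l) * z ^+ (j * (k - l)).
  by rewrite -exprD -mulnDr subnKC.
by rewrite mulrA expr_div_n -exprM divfK // expf_neq0.
Qed.

Lemma size_homogenize (p u : {poly C}) j k : (j < size u)%N ->
  (size (homogenize p u j k) <= ((size u).-1 * k).+1)%N.
Proof.
move=> ju; apply: (leq_trans (size_sum _ _ _)); apply/bigmax_leqP => l _.
apply: (leq_trans (size_scale_leq _ _)); apply: (leq_trans (size_polyMleq _ _)).
have := size_poly_exp_leq u l; rewrite size_polyXn.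
have lk : (l <= k)%N by rewrite -ltnS.
have : (j * (k - l) <= (size u).-1 * (k - l))%N.
  by rewrite leq_mul2r; apply/orP; right; lia.
have := mulnDr (size u).-1 l (k - l)%N; rewrite (subnKC lk).
move: (size (u ^+ l)) => s; lia.
Qed.

Lemma lead_coef_deg (R : nzRingType) (p : {poly R}) n :
  (size p <= n.+1)%N -> p`_n != 0 -> lead_coef p = p`_n.
Proof.
move=> sp pn; rewrite lead_coefE; congr (_`_ _); apply/eqP.
rewrite eqn_leq -subn1 leq_subLR add1n sp /= subn1 -ltnS.
apply: leq_trans (leqSpred _); rewrite ltnNge; apply: contra pn => ps.
by rewrite nth_default.
Qed.

Lemma crossZr u v (l : C) : cross u (l *: v) = l%:P%:P * cross u v.
Proof. by have := cross_linr u v 0 l; rewrite scale0r add0r. Qed.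

End CrossCalculus.

(** * Interpolation on the fibres of q = u / z^j *)

Section Interpolation.
Variable C : numClosedFieldType.
Implicit Types (h u v p : {poly C}).

Lemma interpolation (f : nat -> C) k : exists p,
  (size p <= k.+1)%N /\ forall i, (i < k.+1)%N -> p.[i%:R] = f i.
Proof.
pose x (i : nat) : C := i%:R.
have x_inj : injective x by move=> i l /eqP; rewrite eqr_nat => /eqP.
exists (\sum_(i < k.+1) f i *: (tnth (lagrange k.+1 x) i : {poly C})); split.
  apply: (leq_trans (size_sum _ _ _)); apply/bigmax_leqP => i _.
  by apply: (leq_trans (size_scale_leq _ _)); rewrite size_lagrange_.
move=> i ik; rewrite horner_sum (bigD1 (Ordinal ik)) //= hornerZ.
rewrite (lagrange_sample _ x_inj (Ordinal ik) (Ordinal ik)) // eqxx mulr1.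
rewrite big1 ?addr0 // => l li; rewrite hornerZ.
by rewrite (lagrange_sample _ x_inj l (Ordinal ik)) // (negPf li) mulr0.
Qed.

Lemma size_pencil u j t : (j.+1 < size u)%N -> size (u - t *: 'X^j) = size u.
Proof.
move=> ju; rewrite size_polyDl // size_polyN.
by apply: (leq_ltn_trans (size_scale_leq _ _)); rewrite size_polyXn.
Qed.

Lemma pencil_root_neq0 u j t z : (0 < j)%N -> u.[0] != 0 ->
  root (u - t *: 'X^j) z -> z != 0.
Proof.
move=> j0 u0; apply: contraTneq => ->.
by rewrite /root !hornerE expr0n eqn0Ngt j0 /= mulr0 oppr0 addr0.
Qed.

(** A common root z is nonzero, since u(0) is, and would satisfy t z^j = t' z^j. *)
Lemma pencil_coprime u j t t' : (0 < j)%N -> u.[0] != 0 -> t != t' ->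
  coprimep (u - t *: 'X^j) (u - t' *: 'X^j).
Proof.
move=> j0 u0 tt'; apply: Pdiv.ClosedField.root_coprimep => x ux.
have x0 := pencil_root_neq0 j0 u0 ux; move: ux => /rootP.
rewrite !hornerE => /eqP; rewrite subr_eq0 => /eqP ->.
by rewrite -mulrBl mulf_neq0 ?subr_eq0 // expf_neq0.
Qed.

Lemma pencil_prod_dvdp u j k G : (0 < j)%N -> u.[0] != 0 ->
  (forall i, (i < k)%N -> u - i%:R *: 'X^j %| G) ->
  \prod_(i < k) (u - i%:R *: 'X^j) %| G.
Proof.
move=> j0 u0; elim: k => [|k IH] dG; first by rewrite big_ord0 dvd1p.
rewrite big_ord_recr /= Gauss_dvdp; last first.
  elim/big_ind: _ => [|x y|i _]; [exact: coprime1p|by rewrite coprimepMl => -> ->|].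
  by apply: pencil_coprime => //; rewrite eqr_nat ltn_eqF.
by rewrite dG // IH // => i ik; apply: dG; exact: ltnW.
Qed.

(** Here q = u / z^j has a pole at infinity, so q = i is solvable for every natural i. The
    divisibility makes h / X^M constant on this fibre; a polynomial in q interpolating these
    constants on enough fibres is equal to h / X^M. *)
Lemma polynomial_in_quotient u j h M Q :
  (0 < j)%N -> u.[0] != 0 -> (j.+1 < size u)%N ->
  cross h 'X^M = Q * cross u 'X^j ->
  exists p, forall z, z != 0 -> h.[z] / z ^+ M = p.[u.[z] / z ^+ j].
Proof.
move=> j0 u0 ju hQ; pose D (i : nat) := u - i%:R *: 'X^j.
have sD i : size (D i) = size u by exact: size_pencil.
have exz i : exists z, root (D i) z by apply: size_neq1_root; rewrite sD; lia.
have [z zP] := choice exz.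
have z0 i : z i != 0 by exact: pencil_root_neq0 (zP i).
pose f i := h.[z i] / z i ^+ M.
(* With the inner variable set to [z i], [cross u 'X^j] becomes a nonzero multiple of [D i], which
   therefore divides h - f_i X^M, multiplicities included. *)
have hD i : D i %| h - f i *: 'X^M.
  have uz : u.[z i] = i%:R * z i ^+ j.
    by have /rootP := zP i; rewrite /D !hornerE => /eqP; rewrite subr_eq0 => /eqP.
  have := congr1 (map_poly (horner_eval (z i))) hQ.
  rewrite rmorphM /= !eval_cross !hornerXn uz [_%:R * _]mulrC.
  rewrite -(scalerA (z i ^+ j)) -scalerBr -/(D i) => e.
  rewrite -(dvdpZr _ _ (expf_neq0 M (z0 i))) scalerBr scalerA.
  by rewrite mulrC divfK ?expf_neq0 // e dvdp_mull // dvdpZr ?expf_neq0.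
(* G is divisible by the pairwise coprime D i with i <= k, whose product is
   larger than G. *)
pose k := (M + size h)%N; have [p [sp pE]] := interpolation f k.
have Mjk : (M <= j * k)%N by rewrite (leq_trans (leq_addr (size h) M)) // leq_pmull.
pose G := h * 'X^(j * k - M) - homogenize p u j k.
have DG i : (i < k.+1)%N -> D i %| G.
  move=> ik; have -> : G = (h - f i *: 'X^M) * 'X^(j * k - M)
      + (f i *: 'X^(j * k) - homogenize p u j k).
    by rewrite mulrBl -scalerAl -exprD subnKC // addrA subrK.
  apply: dvdp_add; first exact: dvdp_mulr.
  by rewrite -pE //; exact: homogenize_mod.
have G0 : G = 0.
  apply/eqP/negPn/negP => nG.
  have := dvdp_leq nG (pencil_prod_dvdp j0 u0 DG).
  rewrite size_prod => [|i _]; last by rewrite -size_poly_gt0 sD; lia.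
  under eq_bigr do rewrite sD; rewrite sum_nat_const card_ord.
  have : (size G <= ((size u).-1 * k.+1))%N.
    apply: (leq_trans (size_polyD _ _)); rewrite size_polyN geq_max; apply/andP; split.
      apply: (leq_trans (size_polyMleq _ _)); rewrite size_polyXn.
      have : (j.+1 * k <= (size u).-1 * k)%N by rewrite leq_mul2r; apply/orP; right; lia.
      have : (size h <= k)%N by rewrite leq_addl.
      by rewrite mulSn mulnS; move: (j * k)%N ((size u).-1 * k)%N => b c; lia.
    apply: (leq_trans (size_homogenize p k (ltnW ju))).
    rewrite mulnS -add1n leq_add2r; lia.
  move: ju; case: (size u) => // s _.
  rewrite /= mulnS [(k.+1 * _)%N]mulnC mulSn mulnS => h1 h2.
  by have := leq_trans h2 h1; rewrite -addnS addKn ltnn.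
exists p => y y0; have := congr1 (horner^~ y) G0.
rewrite /G hornerD hornerN horner_homogenize // hornerM hornerXn horner0.
move/eqP; rewrite subr_eq0 -[in X in _ == X](subnKC Mjk) exprD mulrA [X in _ == X]mulrC.
rewrite [X in X == _]mulrC (inj_eq (mulfI (expf_neq0 _ y0))) => /eqP ->.
by rewrite mulfK ?expf_neq0.
Qed.

End Interpolation.

(** * Algebras of Laurent polynomials with vanishing constant terms *)

Section IsotropicAlgebra.
Variable C : numClosedFieldType.
Implicit Types (f g h c u v p : {poly C}).

Lemma prim_root_exists n : (0 < n)%N -> exists z : C, n.-primitive_root z.
Proof.
move=> n_gt0; pose p : {poly C} := 'X^n - 1.
have [r Dp] := closed_field_poly_normal p.
rewrite (monicP _) ?monicXnsubC // scale1r in Dp.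
have rn1 : all n.-unity_root r by apply/allP=> z; rewrite -root_prod_XsubC -Dp.
have sz_r : (n < (size r).+1)%N.
  by rewrite -(size_prod_XsubC r id) -Dp size_XnsubC.
have [|z] := hasP (has_prim_root n_gt0 rn1 _ sz_r); last by exists z.
by rewrite -separable_prod_XsubC -Dp separable_Xn_sub_1 // pnatr_eq0 -lt0n.
Qed.

Variable B : nat -> {poly C} -> Prop.
Hypothesis algB : laurent_subalgebra B.
(* The constant term of f * z g' vanishes for f = h / X^N and g / X^M in B. *)
Hypothesis isoB : forall N M h g, B N h -> B M g ->
  (h * ('X * g^`() - g *+ M))`_(N + M) = 0.

(** Powers of X common to numerator and denominator cancel; a remaining N' > 0 is the exact order of
    the pole at 0. *)
Lemma lsub_reduce N h : B N h -> exists N' h' k,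
  [/\ B N' h', N = (k + N')%N, h = 'X^k * h' & N' = 0%N \/ h'.[0] != 0].
Proof.
elim: N h => [|N IH] h Bh; first
  by exists 0%N, h, 0%N; rewrite mul1r; split=> //; left.
have [h0|h0] := eqVneq h.[0] 0; last first.
  by exists N.+1, h, 0%N; rewrite mul1r; split=> //; right.
have /factor_theorem[h1 hE] : root h 0 by apply/rootP.
rewrite subr0 mulrC in hE.
have [N' [h' [k [Bh' -> h1E p]]]] : exists N' h' k,
  [/\ B N' h', N = (k + N')%N, h1 = 'X^k * h' & N' = 0%N \/ h'.[0] != 0].
  by apply: IH; apply/(lsubX algB); rewrite -hE.
by exists N', h', k.+1; split=> //; rewrite hE h1E mulrA exprS.
Qed.

Lemma factor_X h : h != 0 -> exists m h', h = 'X^m * h' /\ h'.[0] != 0.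
Proof.
move=> h0; have [m [h' /implyP h'0 hE]] := multiplicity_XsubC h 0.
by exists m, h'; rewrite mulrC -['X]subr0; split=> //; apply: h'0.
Qed.

(** Subtracting f(0) gives a zero of some order m at 0. Pairing the N-th power of the difference
    with g^m, whose pole has order m N, gives the constant term -m N f1(0)^N g(0)^m, against
    [isoB]. *)
Lemma no_zero_and_pole N f g : B 0 f -> (1 < size f)%N ->
  B N g -> g.[0] != 0 -> (0 < N)%N -> False.
Proof.
move=> Bf sf Bg g0 N0; pose f' := f - f.[0]%:P.
have f'0 : f' != 0.
  by rewrite subr_eq0; apply: contraTneq sf => ->; rewrite -leqNgt size_polyC_leq1.
have [m [f1 [fE f10]]] := factor_X f'0.
have m0 : (0 < m)%N.
  rewrite lt0n; apply: contraNneq f10 => m0.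
  by rewrite m0 mul1r in fE; rewrite -fE /f' !hornerE subrr.
have Bf' : B 0 f' by apply: (lsubB algB) => //; exact: lsubC algB _.
have := isoB (lsub_exp algB N Bf') (lsub_exp algB m Bg).
rewrite mul0n add0n fE exprMn -exprM -mulrA coefXnM mulnC ltnn subnn.
rewrite -horner_coef0 !(hornerM, hornerD, hornerN, hornerMn, horner_exp).
rewrite hornerX mul0r add0r.
move/eqP; rewrite mulf_eq0 expf_eq0 (negPf f10) andbF /= oppr_eq0 mulrn_eq0.
by rewrite muln_eq0 !gtn_eqF //= expf_eq0 (negPf g0) andbF.
Qed.

(* Substitute Y = zeta z with zeta a primitive j-th root of unity. *)
Lemma lsub_exponents N h (c : C) j :
  (0 < j)%N -> c != 0 -> (exists Q, c%:P%:P * cross h 'X^N = Q * cross 1 'X^j) ->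
  forall i, h`_i != 0 -> i = N %[mod j].
Proof.
move=> j0 c0 [Q hQ] i hi; have [z pz] := prim_root_exists j0.
apply/eqP; rewrite -(eq_prim_root_expr pz).
have := congr1 (fun S : {poly {poly C}} => S.[z *: 'X]) hQ.
rewrite hornerM hornerC [X in _ = X]hornerM.
have crossE u M : (cross u 'X^M).[z *: 'X] = (u \Po (z *: 'X) - z ^+ M *: u) * 'X^M.
  rewrite /cross hornerD hornerN !hornerM !hornerC -!/(comp_poly _ _) comp_Xn_poly.
  by rewrite exprZn mulrBl -!scalerAl (mulrC u).
rewrite !crossE (prim_expr_order pz) comp_polyC scale1r subrr mul0r mulr0.
have Xn0 : 'X^N != 0 :> {poly C} by rewrite -size_poly_eq0 size_polyXn.
move=> /eqP; rewrite !mulf_eq0 !polyC_eq0 (negPf c0) (negPf Xn0) orbF /=.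
rewrite subr_eq0 => /eqP/(congr1 (fun p : {poly C} => p`_i)).
have -> : (h \Po (z *: 'X))`_i = h`_i * z ^+ i.
  rewrite comp_polyE (eq_bigr (fun l : 'I__ => (h`_l * z ^+ l) *: 'X^l)) => [|l _].
    rewrite -(poly_def _ (fun l => h`_l * z ^+ l)) coef_poly; case: ltnP => // ?.
    by rewrite nth_default // mul0r.
  by rewrite exprZn scalerA.
by rewrite coefZ mulrC => /(mulIf hi) ->.
Qed.

(** * Multiples of all powers of z^j *)

Section Conductor.
Variables (j N S : nat) (c g : {poly C}).
Hypotheses (j_gt0 : (0 < j)%N) (Bc : B N c) (BcX : B N (c * 'X^j)).
Hypotheses (Bg : B S g) (s_g : (S < (size g).-1)%N).
Hypothesis j_S : (j %| S)%N.
Hypothesis j_g : forall i, g`_i != 0 -> (j %| i)%N.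

Let k := ((size g).-1 %/ j)%N.

Let gtop : g`_(size g).-1 != 0.
Proof.
rewrite -lead_coefE lead_coef_eq0; apply: contraTneq s_g => ->.
by rewrite size_poly0.
Qed.

Let kE : (k * j = (size g).-1)%N.
Proof. by rewrite divnK //; exact: j_g. Qed.

(* For i > k, multiply the case of smaller exponents by g and use its leading
   term. *)
Lemma conductor i : B (N * k)%N (c ^+ k * 'X^(j * i)).
Proof.
have [n] := ubnP i; elim: n i => // n IH i; rewrite ltnS => le_i.
have [ik|ki] := leqP i k.
  have -> : c ^+ k * 'X^(j * i) = c ^+ (k - i) * (c * 'X^j) ^+ i.
    by rewrite exprMn mulrA -exprD subnK // exprM.
  rewrite -[in (N * k)%N](subnK ik) mulnDr.
  by apply: (lsubM algB); exact: lsub_exp.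
have [s Ss] : exists s, S = (s * j)%N by exists (S %/ j)%N; rewrite divnK.
have sk : (s < k)%N by rewrite -(ltn_pmul2r j_gt0) -Ss kE.
have BY : B (N * k)%N (c ^+ k * 'X^(j * (i - k)) * g).
  apply/(lsubXn algB S).
  have -> : 'X^S * (c ^+ k * 'X^(j * (i - k)) * g) =
      g * (c ^+ k * 'X^(j * (s + (i - k)))).
    rewrite mulnDr exprD Ss [(j * s)%N]mulnC; ring.
  by apply: (lsubM algB) => //; apply: IH; lia.
(* The top term of g produces the wanted X^(j i); the other terms give multiples of j below j i,
   covered by induction. *)
have gE : g = \sum_(l < (size g).-1) g`_l *: 'X^l + g`_(size g).-1 *: 'X^(k * j).
  rewrite -{1}[g]coefK poly_def (polySpred (_ : g != 0)) ?big_ord_recr //= ?kE //.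
  by apply: contraNneq gtop => ->; rewrite coef0.
rewrite gE mulrDr mulr_sumr -scalerAr -mulrA -exprD in BY.
have ji : (j * (i - k) + k * j = j * i)%N by rewrite (mulnC k) -mulnDr subnK // ltnW.
rewrite ji in BY.
set Z := \sum_(l < _) _ in BY.
have BZ : B (N * k)%N Z.
  apply: (lsub_sum algB) => l _; have [gl|gl] := eqVneq g`_l 0.
    by rewrite gl scale0r mulr0; exact: lsub0.
  have /dvdnP[l' lE] := j_g gl.
  rewrite -scalerAr -mulrA -exprD lE [(l' * j)%N]mulnC -mulnDr.
  apply: (lsubZ algB); apply: IH; apply: leq_trans le_i.
  by rewrite -ltnS; have : (l' < k)%N; [rewrite -(ltn_pmul2r j_gt0) -lE kE|lia].
have -> : c ^+ k * 'X^(j * i) = (g`_(size g).-1)^-1 *: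
    (Z + g`_(size g).-1 *: (c ^+ k * 'X^(j * i)) - Z).
  by rewrite addrC addKr scalerA mulVf // scale1r.
by apply: (lsubZ algB); exact: (lsubB algB).
Qed.

End Conductor.

(** [conductor] supplies an f whose order at 0 is opposite to that of g. The constant term of f * z
    g' is then -S times the product of the lowest coefficients. *)
Lemma no_conductor j N S c g : (0 < j)%N -> c != 0 -> B N c -> B N (c * 'X^j) ->
  B S g -> (0 < S)%N -> g.[0] != 0 -> (S < (size g).-1)%N ->
  (forall M h, B M h -> forall i, h`_i != 0 -> i = M %[mod j]) -> False.
Proof.
move=> j0 c0 Bc BcX Bg S0 g0 Sg expo.
have j_S : (j %| S)%N.
  have := expo _ _ Bg 0%N; rewrite -horner_coef0 => /(_ g0)/esym/eqP.
  by rewrite mod0n.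
have j_g i : g`_i != 0 -> (j %| i)%N.
  by move=> /(expo _ _ Bg) e; rewrite /dvdn e.
have [r [c1 [cE c10]]] := factor_X c0.
have rN : r = N %[mod j].
  by apply: (expo _ _ Bc); rewrite cE coefXnM ltnn subnn -horner_coef0.
(* Multiplying c by a power of g makes room for an exponent j * i bringing the
   lowest coefficient to the constant term. *)
pose c' := c * g ^+ r; pose N' := (N + S * r)%N; pose k := ((size g).-1 %/ j)%N.
have Bgo := lsub_exp algB r Bg.
have Bc' : B N' c' by exact: (lsubM algB).
have BcX' : B N' (c' * 'X^j) by rewrite /c' mulrAC; exact: (lsubM algB).
have rN' : (r <= N')%N by rewrite /N' (leq_trans _ (leq_addl _ _)) // leq_pmull.
(* Divisibility holds because r = N modulo j and j divides S; then i solves r k + j i = N' k + S. *)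
have /dvdnP[i iE] : (j %| N' * k + S - r * k)%N.
  have -> : (N' * k + S - r * k = (N' - r) * k + S)%N.
    by rewrite mulnBl addnBAC // leq_mul2r rN' orbT.
  rewrite dvdn_add // dvdn_mulr // -eqn_mod_dvd // eq_sym rN.
  by rewrite /N' -modnDmr (eqP (dvdn_mulr r j_S)) addn0.
have := isoB (conductor j0 Bc' BcX' Bg Sg j_S j_g i) Bg.
have -> : (N' * k + S = r * k + j * i)%N.
  rewrite (mulnC j) -iE subnKC // (leq_trans _ (leq_addr _ _)) //.
  by rewrite leq_mul2r rN' orbT.
rewrite /c' cE !exprMn -!mulrA.
set w := 'X * g^`() - g *+ S.
have -> : 'X^r ^+ k * (c1 ^+ k * ((g ^+ r) ^+ k * ('X^(j * i) * w))) =
    'X^(r * k + j * i) * (c1 ^+ k * ((g ^+ r) ^+ k * w)).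
  by rewrite exprD -['X^r ^+ k]exprM; ring.
rewrite coefXnM ltnn subnn -horner_coef0 /w.
rewrite !(hornerM, hornerD, hornerN, hornerMn, horner_exp) hornerX mul0r add0r => /eqP.
rewrite !mulf_eq0 !expf_eq0 (negPf c10) (negPf g0) !andbF /= oppr_eq0 mulrn_eq0.
by rewrite (negPf g0) gtn_eqF.
Qed.

(** The Luroth pair is normalized: after a swap u(0) is nonzero, and v is replaced by v(0) u - u(0)
    v, which vanishes at 0. Setting z = 0 in the divisibility for g shows that this combination
    divides g(0) X^S, so it is a monomial of positive degree. *)
Lemma normal_pair S g : B S g -> (0 < S)%N -> g.[0] != 0 -> (S < (size g).-1)%N ->
  exists N c u j, [/\ c != 0, (0 < j)%N, B N (c * u) & B N (c * 'X^j)] /\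
    [/\ u.[0] != 0, cross u 'X^j != 0 &
      forall M h, B M h -> exists Q, cross h 'X^M = Q * cross u 'X^j].
Proof.
move=> Bg S0 g0 Sg; have ig : ~ lindep g 'X^S.
  move=> [/eqP|[l gl]]; first by rewrite -size_poly_eq0 size_polyXn.
  have := size_scale_leq l ('X^S : {poly C}); rewrite -gl size_polyXn.
  by move: Sg; rewrite ltnNge -subn1 leq_subLR add1n => /negPf ->.
have [N [c [u [v [[c0 Bu Bv iuv] [no_common divB]]]]]] := luroth_pair algB Bg ig.
have uv0 : cross u v != 0 by apply/eqP => /cross_eq0.
have [u1 [v1 [[Bu1 Bv1] [n1 u10 divB1]]]] : exists u1 v1,
    [/\ B N (c * u1) & B N (c * v1)] /\ [/\ cross u1 v1 != 0, u1.[0] != 0 &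
      forall M h, B M h -> exists Q, cross h 'X^M = Q * cross u1 v1].
  have [u0|u0] := eqVneq u.[0] 0; last by exists u, v.
  exists v, u; split=> //; split; first by rewrite crossC oppr_eq0.
    exact: no_common.
  by move=> M h /divB[Q ->]; exists (- Q); rewrite (crossC u v) mulrNN.
pose v' := v1.[0] *: u1 + - u1.[0] *: v1.
have nv' : v' != 0.
  apply: contraNneq n1 => z; have := cross_linr u1 v1 v1.[0] (- u1.[0]).
  rewrite -/v' z lindep_cross; last by left.
  by move/esym/eqP; rewrite mulf_eq0 !polyC_eq0 oppr_eq0 (negPf u10).
have [l [j [l0 v'E]]] : exists l j, l != 0 /\ v' = l *: 'X^j.
  apply: (@monomial_dvdp _ _ (- g.[0]) S); first by rewrite oppr_eq0.
  have [Q /(congr1 (map_poly (horner_eval 0)))] := divB1 _ _ Bg.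
  rewrite rmorphM /= !eval_cross hornerXn expr0n gtn_eqF // scale0r add0r.
  by rewrite -!scaleNr -/v' => ->; exact: dvdp_mull.
have j0 : (0 < j)%N.
  rewrite lt0n; apply: contraNneq l0 => j0; have := congr1 (horner^~ 0) v'E.
  by rewrite j0 /v' !hornerE mulNr mulrC subrr => <-.
exists N, c, u1, j; split; [split=> //|split=> //].
- have -> : 'X^j = l^-1 *: v' by rewrite v'E scalerA mulVf // scale1r.
  rewrite -scalerAr /v' mulrDr -!scalerAr.
  by apply: (lsubZ algB); apply: (lsubD algB); exact: (lsubZ algB).
- apply: contraNneq n1 => z; have := cross_linr u1 v1 v1.[0] (- u1.[0]).
  rewrite -/v' v'E crossZr z mulr0 => /esym/eqP.
  by rewrite mulf_eq0 !polyC_eq0 oppr_eq0 (negPf u10).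
move=> M h /divB1[Q ->]; exists (Q * ((- u1.[0])^-1 * l)%:P%:P).
rewrite -mulrA; congr (_ * _); apply: (@mulfI _ (- u1.[0])%:P%:P).
  by rewrite !polyC_eq0 oppr_eq0.
rewrite -(cross_linr _ _ v1.[0]) -/v' v'E crossZr mulrA; congr (_ * _).
by rewrite -!polyCM mulrA mulfV ?oppr_eq0 // mul1r.
Qed.

(** Leading coefficients in Y are compared: that of [cross g 'X^S] is a multiple of X^S, that of
    [cross u 'X^j] is -w with w = u - u_j X^j. So w is a monomial, and it is constant since w(0) =
    u(0) is nonzero. *)
Lemma degenerate_pair S g u j Q : (0 < j)%N -> u.[0] != 0 -> (size u <= j.+1)%N ->
  cross u 'X^j != 0 -> (S < (size g).-1)%N ->
  cross g 'X^S = Q * cross u 'X^j ->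
  exists2 l, l != 0 & u = l%:P + u`_j *: 'X^j.
Proof.
move=> j0 u0 uj nu Sg gQ; pose w := u - u`_j *: 'X^j.
have uE : u = 1 *: w + u`_j *: 'X^j by rewrite scale1r subrK.
have crossE : cross u 'X^j = cross w 'X^j.
  by rewrite crossC [in LHS]uE addrC cross_linr mul1r -crossC.
have wj : w`_j = 0 by rewrite coefB coefZ coefXn eqxx mulr1 subrr.
have w0 : w != 0.
  apply: contraNneq nu => z; rewrite crossE lindep_cross //.
  by right; exists 0; rewrite z scale0r.
have sw : (size w <= j.+1)%N.
  rewrite (leq_trans (size_polyD _ _)) // size_polyN geq_max uj.
  by rewrite (leq_trans (size_scale_leq _ _)) // size_polyXn.
have lead_w : lead_coef (cross u 'X^j) = - w.
  rewrite (@lead_coef_deg _ _ j).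
  - by rewrite crossE coef_cross wj scale0r coefXn eqxx scale1r sub0r.
  - by rewrite (leq_trans (size_cross _ _)) // geq_max uj size_polyXn leqnn.
  by rewrite crossE coef_cross wj scale0r coefXn eqxx scale1r sub0r oppr_eq0.
have gtop : g`_(size g).-1 != 0.
  by rewrite -lead_coefE lead_coef_eq0; apply: contraTneq Sg => ->; rewrite size_poly0.
have gcoef : (cross g 'X^S)`_(size g).-1 = g`_(size g).-1 *: 'X^S.
  by rewrite coef_cross coefXn gtn_eqF // scale0r subr0.
have lead_g : lead_coef (cross g 'X^S) = g`_(size g).-1 *: 'X^S.
  rewrite (@lead_coef_deg _ _ (size g).-1) //.
    rewrite (leq_trans (size_cross _ _)) // geq_max size_polyXn leqSpred.
    exact: ltnW.
  by rewrite gcoef scaler_eq0 negb_or gtop -size_poly_eq0 size_polyXn.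
have [l [m [l0 wE]]] : exists l m, l != 0 /\ w = l *: 'X^m.
  apply: (@monomial_dvdp _ _ _ S gtop); rewrite -lead_g gQ lead_coefM lead_w.
  by rewrite -dvdpNr mulrN opprK; exact: dvdp_mull.
exists l => //; rewrite {1}uE scale1r wE; congr (_ + _).
have : w.[0] != 0 by rewrite /w !hornerE expr0n gtn_eqF // mulr0 oppr0 addr0.
rewrite wE !hornerE expr0n; case: m {wE} => [|m]; last by rewrite mulr0 eqxx.
by rewrite expr0 alg_polyC.
Qed.

Lemma isotropic_subalgebra_composite : exists u j, forall M h, B M h ->
  exists p, forall z, z != 0 -> h.[z] / z ^+ M = p.[u.[z] / z ^+ j].
Proof.
(* No pole at 0: q = z. *)
have [reg0|] := pselect (forall N h, B N h -> 'X^N %| h).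
  exists 'X, 0%N => M h /reg0/dvdpP[p ->]; exists p => z z0.
  by rewrite hornerM !hornerXn hornerX divr1 mulfK // expf_neq0.
move=> /existsNP[N1 /existsNP[h1 /not_implyP[Bh1 h1X]]].
(* No pole at infinity: q = 1 / z, with the coefficients of h read backwards. *)
have [regi|] := pselect (forall N h, B N h -> (size h <= N.+1)%N).
  exists 1, 1%N => M h /regi sh; exists (\poly_(i < M.+1) h`_(M - i)) => z z0.
  rewrite (horner_coef_wide _ sh) horner_poly mulr_suml (reindex_inj rev_ord_inj) /=.
  apply: eq_bigr => i _; have iM : (i <= M)%N by rewrite -ltnS.
  rewrite subSS hornerC expr1 -mulrA; congr (_ * _).
  have -> : z ^+ M = z ^+ (M - i) * z ^+ i by rewrite -exprD subnK.
  by rewrite div1r exprVn invfM mulrA mulfV ?expf_neq0 // mul1r.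
move=> /existsNP[N2 /existsNP[h2 /not_implyP[Bh2 /negP]]]; rewrite -ltnNge => sh2.
(* In lowest terms, g1 / X^N has a pole at 0 and g / X^S one at infinity. *)
have [N [g1 [k1 [Bg1 N1E h1E p1]]]] := lsub_reduce Bh1.
have [S [g [k2 [Bg N2E h2E p2]]]] := lsub_reduce Bh2.
have {p1} [N0 g10] : (0 < N)%N /\ g1.[0] != 0.
  case: p1 => [N0|g10].
    by case: h1X; rewrite h1E N1E N0 addn0 dvdp_mulIl.
  rewrite lt0n; split=> //; apply/eqP => N0.
  by case: h1X; rewrite h1E N1E N0 addn0 dvdp_mulIl.
have Sg : (S < (size g).-1)%N.
  have g0 : g != 0 by apply: contraTneq sh2 => z; rewrite h2E z mulr0 size_poly0.
  move: sh2; rewrite h2E N2E mulrC size_mulXn // (polySpred g0); lia.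
(* Without a pole at 0, g would be a nonconstant polynomial in B next to g1, which
   [no_zero_and_pole] excludes. *)
have {p2} [S0 g0] : (0 < S)%N /\ g.[0] != 0.
  have S0 : (0 < S)%N.
    rewrite lt0n; apply/eqP => S0; move: Bg Sg; rewrite S0 => Bg Sg.
    by apply: (no_zero_and_pole Bg _ Bg1 g10 N0); lia.
  by split=> //; case: p2 => // S00; rewrite S00 in S0.
have [M [c [u [j [[c0 j0 Bu BX] [u0 nu divB]]]]]] := normal_pair Bg S0 g0 Sg.
have [ju|uj] := ltnP j.+1 (size u).
  exists u, j => M' h /divB[Q hQ].
  exact: polynomial_in_quotient j0 u0 ju hQ.
(* The remaining case is q = l z^(-j) + u_j: the pair (u, z^j) may be replaced by (1, z^j), and
   [no_conductor] applies. *)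
have [Qg gQ] := divB _ _ Bg.
have [l l0 uE] := degenerate_pair j0 u0 uj nu Sg gQ.
have Bc : B M c.
  have -> : c = l^-1 *: (c * u - u`_j *: (c * 'X^j)).
    by rewrite {1}uE mulrDr scalerAr addrK mulrC mul_polyC scalerA mulVf // scale1r.
  by apply: (lsubZ algB); apply: (lsubB algB) => //; exact: (lsubZ algB).
exfalso; apply: (no_conductor j0 c0 Bc BX Bg S0 g0 Sg) => M' h Bh.
apply: (@lsub_exponents _ _ 1); rewrite ?oner_eq0 //.
have [Q hQ] := divB _ _ Bh; exists (Q * l%:P%:P).
rewrite mul1r hQ -mulrA; congr (_ * _).
by have := cross_linl 1 'X^j l u`_j; rewrite alg_polyC -uE.
Qed.

End IsotropicAlgebra.

(** * Trigonometric polynomials as Laurent polynomials in expi *)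

Section LaurentFunctions.
Variable R : realType.
Implicit Types (F G : R -> R[i]) (h g p : {poly R[i]}).
Local Notation I := (0 +i* 1 : R[i]).

Lemma I_neq0 : I != 0.
Proof. by rewrite eq_complex /= oner_eq0 andbF. Qed.

Lemma expiD x y : expi (x + y) = expi x * expi y :> R[i].
Proof.
rewrite /expi cosD sinD; apply/eqP.
by rewrite eq_complex /= !eqxx /= addrC mulrC eqxx.
Qed.

Lemma expi0 : expi 0 = 1 :> R[i].
Proof. by rewrite /expi cos0 sin0. Qed.

Lemma expi_neq0 x : expi x != 0 :> R[i].
Proof.
apply/eqP => e0; have := expiD x (- x).
by rewrite subrr expi0 e0 mul0r => /eqP; rewrite oner_eq0.
Qed.

Lemma expiN x : expi (- x) = (expi x)^-1 :> R[i].
Proof.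
by apply: (mulfI (expi_neq0 x)); rewrite -expiD subrr expi0 mulfV // expi_neq0.
Qed.

Lemma expi_nat (k : nat) x : expi (k%:R * x) = expi x ^+ k :> R[i].
Proof.
elim: k => [|k IH]; first by rewrite mul0r expi0.
by rewrite -natr1 mulrDl mul1r expiD IH exprSr.
Qed.

Lemma expi_int (k : int) x : expi (k%:~R * x) = expi x ^ k :> R[i].
Proof.
case: k => k; first exact: expi_nat.
by rewrite NegzE mulrNz mulNr expiN expi_nat.
Qed.

Lemma cderiv_expi : cderiv (@expi R) (fun x => I * expi x).
Proof.
move=> x; split; rewrite /expi /=.
  apply: (is_derive_eq (is_derive_cos x)); by rewrite mul0r mul1r sub0r.
apply: (is_derive_eq (is_derive_sin x)); by rewrite mul0r mul1r add0r.
Qed.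

Lemma cderiv_horner F G p : cderiv F G ->
  cderiv (fun x => p.[F x]) (fun x => p^`().[F x] * G x).
Proof.
move=> dF; elim/poly_ind: p => [|p c IH].
  by apply: eq_cderiv (cderiv_cst 0) => x; rewrite ?deriv0 horner0 ?mul0r.
apply: eq_cderiv (cderivD (cderivM IH dF) (cderiv_cst c)) => x.
  by rewrite hornerMXaddC.
rewrite derivMXaddC !hornerE; ring.
Qed.

Lemma cderiv_inj F G1 G2 : cderiv F G1 -> cderiv F G2 -> G1 =1 G2.
Proof.
move=> d1 d2 x; have [r1 i1] := d1 x; have [r2 i2] := d2 x.
apply/eqP; rewrite eq_complex; apply/andP; split; apply/eqP.
  by rewrite -(@derive_val _ _ _ _ _ _ _ r1) (@derive_val _ _ _ _ _ _ _ r2).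
by rewrite -(@derive_val _ _ _ _ _ _ _ i1) (@derive_val _ _ _ _ _ _ _ i2).
Qed.

Lemma cderiv_uniq F1 F2 G : ccont G -> cderiv F1 G -> cderiv F2 G ->
  F1 0 = F2 0 -> F1 =1 F2.
Proof.
move=> cG d1 d2 e x; have := cint_uniq 0 x cG d1; rewrite (cint_uniq 0 x cG d2) e.
by move/addIr.
Qed.

Definition laurent N h (x : R) : R[i] := h.[expi x] / expi x ^+ N.

Lemma laurentM N M h g x : laurent (N + M) (h * g) x = laurent N h x * laurent M g x.
Proof. by rewrite /laurent hornerM exprD invfM mulrACA. Qed.

Lemma laurentD N h g x : laurent N (h + g) x = laurent N h x + laurent N g x.
Proof. by rewrite /laurent hornerD mulrDl. Qed.

Lemma laurentZ N c h x : laurent N (c *: h) x = c * laurent N h x.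
Proof. by rewrite /laurent hornerZ mulrA. Qed.

Lemma laurentX N h x : laurent N.+1 ('X * h) x = laurent N h x.
Proof.
rewrite /laurent hornerM hornerX exprS invfM mulrACA.
by rewrite mulfV ?expi_neq0 // mul1r.
Qed.

Lemma laurent0C c x : laurent 0 c%:P x = c.
Proof. by rewrite /laurent hornerC expr0 divr1. Qed.

Lemma laurentXn N x : laurent N 'X^N x = 1.
Proof. by rewrite /laurent hornerXn mulfV // expf_neq0 // expi_neq0. Qed.

Lemma expi_trig (k : int) : exists N h, forall x, expi (k%:~R * x) = laurent N h x.
Proof.
case: k => k.
  by exists 0%N, 'X^k => x; rewrite expi_int /laurent hornerXn divr1.
by exists k.+1, 1 => x; rewrite expi_int /laurent hornerC mul1r NegzE -exprnN.
Qed.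

Lemma laurent_lift k N h x : laurent (k + N) ('X^k * h) x = laurent N h x.
Proof. by rewrite laurentM laurentXn mul1r. Qed.

Lemma trig_polyP F : trig_poly F <-> exists N h, F = laurent N h.
Proof.
split=> [[s Fs]|[N [h ->]]].
  suff [N [h hE]] : exists N h, forall x,
      \sum_(kc <- s) kc.2 * expi (kc.1%:~R * x) = laurent N h x.
    by exists N, h; apply/funext => x; rewrite Fs.
  elim: s {Fs} => [|[k c] s [N [h IH]]].
    by exists 0%N, 0 => x; rewrite big_nil laurent0C.
  have [M [g gE]] := expi_trig k; exists (M + N)%N, (c *: (g * 'X^N) + 'X^M * h) => x.
  rewrite big_cons IH laurentD laurentZ laurentM laurentXn mulr1 laurent_lift.
  by rewrite -gE.
exists [seq (i%:Z - N%:Z, h`_i) | i <- iota 0 (size h)] => x.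
rewrite big_map /laurent horner_coef mulr_suml.
rewrite -(big_mkord xpredT (fun i => h`_i * expi x ^+ i / expi x ^+ N)).
rewrite /index_iota subn0; apply: eq_bigr => i _; rewrite -mulrA; congr (_ * _).
by rewrite expi_int expfzDr ?expi_neq0 // -exprnN.
Qed.

(** With z = expi x, d/dx is i z d/dz, which sends h / z^N to i (z h' - N h) / z^N. *)
Lemma cderiv_laurent N h :
  cderiv (laurent N h) (laurent N (I *: ('X * h^`() - h *+ N))).
Proof.
have dinv : cderiv (fun x => expi (- x)) (fun x : R => - I * expi (- x)).
  apply: (@eq_cderiv _ _ (fun y => cos y +i* - sin y)) (fun=> erefl) _ => [y|].
    by rewrite /expi cosN sinN.
  move=> x; split=> /=.
    apply: (is_derive_eq (is_derive_cos x)).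
    by rewrite sinN !(mul0r, mulNr, mul1r, sub0r, oppr0, opprK, mulrN).
  apply: (is_derive_eq (is_deriveN (is_derive_sin x))).
  by rewrite cosN !(mul0r, mulNr, mul1r, sub0r, oppr0, opprK, mulrN, add0r).
have lE g x : laurent N g x = g.[expi x] * ('X^N).[expi (- x)].
  by rewrite /laurent hornerXn expiN exprVn.
apply: eq_cderiv (cderivM (cderiv_horner h cderiv_expi) (cderiv_horner 'X^N dinv)).
  exact: lE.
move=> x; rewrite lE hornerZ hornerD hornerM hornerX hornerN hornerMn.
rewrite derivXn hornerMn !hornerXn; case: N {lE} => [|N].
  by rewrite !mulr0n expr0; ring.
rewrite succnK exprSr -[h.[_] *+ _]mulr_natr -[_ ^+ N *+ _]mulr_natr.
move: (N.+1%:R) (expi (- x)) (expi (- x) ^+ N) => k E F.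
move: I (expi x) (h.[_]) (h^`().[_]) => i e y y'; ring.
Qed.

Lemma ccont_laurent N h : ccont (laurent N h).
Proof. exact: cderiv_ccont (@cderiv_laurent N h). Qed.

Lemma laurent_periodic N h x : laurent N h (x + 2 * pi) = laurent N h x.
Proof. by apply: trig_poly_periodic; apply/trig_polyP; exists N, h. Qed.

Lemma cderiv_linear (c : R[i]) : cderiv (fun x : R => c * x%:C) (fun=> c).
Proof.
have dx : cderiv (fun x : R => x%:C) (fun=> 1).
  by move=> x; split => /=; [exact: is_derive_id|exact: is_derive_cst].
by apply: eq_cderiv (cderivM (cderiv_cst c) dx) => x //; rewrite mul0r add0r mulr1.
Qed.

(** The term z^(k - N) has the primitive z^(k - N) / (i (k - N)), except for k = N, which yields the
    linear term. *)
Lemma cint_laurent N h : exists g, forall x,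
  cint (laurent N h) 0 x = h`_N * x%:C + laurent N g x.
Proof.
pose g := \poly_(k < size h) (if k == N then 0 else h`_k / (I * (k%:R - N%:R))).
have gE : I *: ('X * g^`() - g *+ N) = h - h`_N *: 'X^N.
  apply/polyP => k; rewrite coefZ !coefB coefMn coefZ coefXn coefXM coef_deriv.
  have gk : g`_k = if k == N then 0 else h`_k / (I * (k%:R - N%:R)).
    rewrite coef_poly; case: ltnP => // hk.
    by rewrite nth_default ?mul0r //; case: ifP.
  have -> : (if k == 0%N then 0 else g`_k.-1.+1 *+ k.-1.+1) = k%:R * g`_k.
    by case: k {gk} => [|k]; rewrite ?mul0r //= mulr_natl.
  rewrite -[g`_k *+ N]mulr_natl -mulrBl gk; have [->|kN] := eqVneq k N.
    by rewrite mulr0 mulr1 !subrr mulr0.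
  rewrite mulr0 subr0; have kN0 : k%:R - N%:R != 0 :> R[i] by rewrite subr_eq0 eqr_nat.
  by rewrite mulrA mulrC divfK // mulf_neq0 // I_neq0.
exists (g - (laurent N g 0) *: 'X^N) => x.
have d : cderiv (fun x => h`_N * x%:C + laurent N g x) (laurent N h).
  apply: eq_cderiv (cderivD (cderiv_linear h`_N) (@cderiv_laurent N g)) => y //.
  rewrite gE laurentD -scaleNr laurentZ laurentXn mulr1 addrC.
  by rewrite subrK.
rewrite (cint_uniq 0 x (@ccont_laurent N h) d) mulr0 add0r -addrA; congr (_ + _).
by rewrite laurentD -[- (_ *: 'X^N)]scaleNr laurentZ laurentXn mulr1.
Qed.

End LaurentFunctions.

(** * Iterated integrals *)

Section IteratedIntegrals.
Variables (R : realType) (n : nat) (a : 'I_n -> R -> R[i]).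
Hypothesis ca : forall i, ccont (a i).
Implicit Types (f g : R -> R[i]) (L : seq 'I_n).

(** The head of [L] is the outermost integration, hence the leftmost letter of the word. *)
Fixpoint iint L : R -> R[i] :=
  if L is i :: L' then cint (fun s => a i s * iint L' s) 0 else fun=> 1.

(** The inductive form allows products and derivatives to be treated by induction; [iter_span_words]
    expresses the elements through the [iint a L]. *)
Inductive iter_span : (R -> R[i]) -> Prop :=
| iter_span1 : iter_span (fun=> 1)
| iter_spanD f g : iter_span f -> iter_span g -> iter_span (fun x => f x + g x)
| iter_spanZ c f : iter_span f -> iter_span (fun x => c * f x)
| iter_spanI i f : iter_span f -> iter_span (cint (fun s => a i s * f s) 0).

Lemma eq_iter_span f g : f =1 g -> iter_span g -> iter_span f.
Proof. by move=> /funext ->. Qed.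

Lemma iter_span_cont f : iter_span f -> ccont f.
Proof.
elim=> {f} [|f g _ cf _ cg|c f _ cf|i f _ cf].
- exact: ccont_cst.
- exact: ccontD.
- by apply: ccontM => //; exact: ccont_cst.
by apply: cderiv_ccont; apply: cint_cderiv; exact: ccontM.
Qed.

Lemma cderiv_iint i f : ccont f ->
  cderiv (cint (fun s => a i s * f s) 0) (fun s => a i s * f s).
Proof. by move=> cf; apply: cint_cderiv; exact: ccontM. Qed.

(** Integration by parts in a double induction: if F' = a_i f and G' = a_j g, then F G has
    derivative a_i (f G) + a_j (F g). *)
Lemma iter_spanM f g : iter_span f -> iter_span g -> iter_span (fun x => f x * g x).
Proof.
move=> Wf; elim: Wf g => {f} [|f1 f2 _ IH1 _ IH2|c f _ IH|i f Wf IHf] g Wg.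
- by apply: eq_iter_span Wg => x; rewrite mul1r.
- by apply: eq_iter_span (iter_spanD (IH1 _ Wg) (IH2 _ Wg)) => x; rewrite mulrDl.
- by apply: eq_iter_span (iter_spanZ c (IH _ Wg)) => x; rewrite mulrA.
elim: Wg => {g} [|g1 g2 _ IH1 _ IH2|c g _ IH|j g Wg IHg].
- by apply: eq_iter_span (iter_spanI i Wf) => x; rewrite mulr1.
- by apply: eq_iter_span (iter_spanD IH1 IH2) => x; rewrite mulrDr.
- by apply: eq_iter_span (iter_spanZ c IH) => x; rewrite mulrCA.
have Wg' := iter_spanI j Wg; have Wfg := IHf _ Wg'.
apply: (eq_iter_span _ (iter_spanD (iter_spanI i Wfg) (iter_spanI j IHg))).
have [cf cg] := (iter_span_cont Wf, iter_span_cont Wg).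
have [cfg cgf] := (iter_span_cont Wfg, iter_span_cont IHg).
have [cIf cIg] := (iter_span_cont (iter_spanI i Wf), iter_span_cont Wg').
apply: (cderiv_uniq _ (cderivM (cderiv_iint i cf) (cderiv_iint j cg))).
- by apply: ccontD; apply: ccontM => //; exact: ccontM.
- apply: eq_cderiv (cderivD (cderiv_iint i cfg) (cderiv_iint j cgf)) => // x.
  by ring.
by rewrite !cint_id mul0r addr0.
Qed.

Lemma iter_span_words f : iter_span f -> exists s : seq (R[i] * seq 'I_n),
  f =1 fun x => \sum_(cL <- s) cL.1 * iint cL.2 x.
Proof.
elim=> {f} [|f g _ [s fE] _ [r gE]|c f _ [s fE]|i f Wf [s fE]].
- by exists [:: (1, [::])] => x; rewrite big_seq1 mul1r.
- by exists (s ++ r) => x; rewrite big_cat /= fE gE.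
- exists [seq (c * cL.1, cL.2) | cL <- s] => x; rewrite big_map fE mulr_sumr.
  by apply: eq_bigr => cL _; rewrite mulrA.
exists [seq (cL.1, i :: cL.2) | cL <- s] => x; rewrite big_map /=.
have cf := iter_span_cont Wf; move: x.
have ciint L : ccont (iint L).
  elim: L => [|l L IH]; first exact: ccont_cst.
  by apply: cderiv_ccont; exact: cderiv_iint.
apply: (cderiv_uniq (ccontM (ca i) cf) (cderiv_iint i cf)).
  apply: (@eq_cderiv _ _ _ _
    (fun x => \sum_(cL <- s) (a i x * iint cL.2 x) * cL.1)) => [x||].
  - by apply: eq_bigr => cL _; rewrite mulrC.
  - move=> x; rewrite fE mulr_sumr; apply: eq_bigr => cL _; by rewrite mulrCA mulrC.
  by apply: cderiv_sum => cL; apply: cderivMr; exact: cderiv_iint.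
by rewrite cint_id big1 // => cL _; rewrite cint_id mulr0.
Qed.

Variable T : R.
Hypothesis iint_T : forall L, L != [::] -> iint L T = 0.

Lemma iter_span_T f : iter_span f -> f T = f 0.
Proof.
move=> /iter_span_words[s fE]; rewrite !fE; apply: eq_bigr => -[c [|i L]] _ //.
by rewrite iint_T //= cint_id.
Qed.

Lemma cintD f g x : ccont f -> ccont g ->
  cint (fun s => f s + g s) 0 x = cint f 0 x + cint g 0 x.
Proof.
move=> cf cg; have := cint_uniq 0 x (ccontD cf cg)
  (cderivD (cint_cderiv 0 cf) (cint_cderiv 0 cg)).
by rewrite !cint_id addr0 subr0.
Qed.

Lemma cintZ c f x : ccont f -> cint (fun s => c * f s) 0 x = c * cint f 0 x.
Proof.
move=> cf; have d : cderiv (fun x => c * cint f 0 x) (fun s => c * f s).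
  apply: eq_cderiv (cderivMr c (cint_cderiv 0 cf)) => y; exact: mulrC.
by rewrite (cint_uniq 0 x (ccontM (ccont_cst c) cf) d) cint_id mulr0 subr0.
Qed.

(** By linearity the essential case is g' = a_i g0 with g0 in the span: f g' = a_i (f g0) integrates
    to an element of the span, which takes the same value at T as at 0. *)
Lemma iter_span_isotropic g : iter_span g -> exists g',
  [/\ cderiv g g', ccont g' &
    forall f, iter_span f -> cint (fun s => f s * g' s) 0 T = 0].
Proof.
elim=> {g} [|g1 g2 _ [d1 [gd1 cd1 i1]] _ [d2 [gd2 cd2 i2]]|c g _ [d [gd cd dT]]|i g Wg _].
- exists (fun=> 0); split; [exact: cderiv_cst|exact: ccont_cst|] => f Wf.
  rewrite (_ : (fun s => _) = fun s => 0 * f s); last by apply/funext => s; rewrite mulrC.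
  by rewrite cintZ ?mul0r //; exact: iter_span_cont.
- exists (fun x => d1 x + d2 x); split; [exact: cderivD|exact: ccontD|] => f Wf.
  have cf := iter_span_cont Wf.
  rewrite (_ : (fun s => _) = fun s => f s * d1 s + f s * d2 s); last first.
    by apply/funext => s; rewrite mulrDr.
  by rewrite cintD ?i1 ?i2 ?addr0 //; exact: ccontM.
- exists (fun x => c * d x); split.
  + by apply: eq_cderiv (cderivMr c gd) => x; exact: mulrC.
  + by apply: ccontM => //; exact: ccont_cst.
  move=> f Wf; have cf := iter_span_cont Wf.
  rewrite (_ : (fun s => _) = fun s => c * (f s * d s)); last first.
    by apply/funext => s; rewrite mulrCA.
  by rewrite cintZ ?dT ?mulr0 //; exact: ccontM.
have cg := iter_span_cont Wg.
exists (fun x => a i x * g x); split; [exact: cderiv_iint|exact: ccontM|] => f Wf.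
rewrite (_ : (fun s => _) = fun s => a i s * (f s * g s)); last first.
  by apply/funext => s; rewrite mulrCA.
by rewrite (iter_span_T (iter_spanI i (iter_spanM Wf Wg))) cint_id.
Qed.

End IteratedIntegrals.

(** * The span as an isotropic algebra of Laurent polynomials *)

Section IsotropicLaurent.
Variables (R : realType) (n : nat) (a : 'I_n -> R -> R[i]).
Hypothesis ta : forall i, trig_poly (a i).
Hypothesis iint_2pi : forall L, L != [::] -> iint a L (2 * pi) = 0.

Let ca i : ccont (a i). Proof. exact: trig_poly_cont. Qed.

Definition laurent_span N h := iter_span a (laurent N h).

Lemma laurent_span_subalgebra : laurent_subalgebra laurent_span.
Proof.
split=> [c|N h k Wh Wk|N M h k Wh Wk|N h].
- apply: eq_iter_span (iter_spanZ c (iter_span1 a)) => x.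
  by rewrite laurent0C mulr1.
- by apply: eq_iter_span (iter_spanD Wh Wk) => x; rewrite laurentD.
- by apply: eq_iter_span (iter_spanM ca Wh Wk) => x; rewrite laurentM.
by split; apply: eq_iter_span => x; rewrite laurentX.
Qed.

(** The integral of a Laurent polynomial over a period is 2 pi times its constant term, and by
    [iter_span_isotropic] it vanishes for f g'. *)
Lemma laurent_span_isotropic N M h g : laurent_span N h -> laurent_span M g ->
  (h * ('X * g^`() - g *+ M))`_(N + M) = 0.
Proof.
move=> Wh Wg; have [g' [dg' cg' ig']] := iter_span_isotropic ca iint_2pi Wg.
have g'E := cderiv_inj dg' (@cderiv_laurent _ M g).
have := ig' _ Wh.
pose k := 'i%C *: (h * ('X * g^`() - g *+ M)).
rewrite (_ : (fun s => _) = laurent (N + M) k); last first.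
  by apply/funext => x; rewrite g'E /k scalerAr laurentM.
have [e eE] := cint_laurent (N + M) k; rewrite eE.
have := eE 0; rewrite cint_id mulr0 add0r => /esym e0.
rewrite -[2 * pi]add0r laurent_periodic e0 addr0 add0r /k coefZ => /eqP.
rewrite !mulf_eq0 (negPf (I_neq0 R)) /= => /orP[/eqP //|].
by rewrite eq_complex /= eqxx andbT mulf_eq0 pnatr_eq0 /= gt_eqF ?pi_gt0.
Qed.

Lemma iint_trivial_composite : exists (q : R -> R[i]) (p : 'I_n -> {poly R[i]}),
  trig_poly q /\ forall i x, cint (a i) 0 x = (p i).[q x].
Proof.
have [u [j uj]] := isotropic_subalgebra_composite laurent_span_subalgebra
  laurent_span_isotropic.
have ex i : exists p : {poly R[i]}, forall x, cint (a i) 0 x = p.[laurent j u x].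
  have [N [h aE]] := (trig_polyP (a i)).1 (ta i).
  have [g gE] := cint_laurent N h.
  (* The integral of [a i] over a period is an iterated integral of length one, so the constant term
     vanishes and the primitive is a Laurent polynomial. *)
  have hN : h`_N = 0.
    have := @iint_2pi [:: i] isT; rewrite /= (_ : (fun s => _) = laurent N h); last first.
      by apply/funext => s; rewrite mulr1 aE.
    rewrite gE; have := gE 0; rewrite cint_id mulr0 add0r => /esym e0.
    rewrite -[2 * pi]add0r laurent_periodic e0 addr0 add0r => /eqP.
    rewrite mulf_eq0 => /orP[/eqP //|].
    by rewrite eq_complex /= eqxx andbT mulf_eq0 pnatr_eq0 /= gt_eqF ?pi_gt0.
  have Wg : laurent_span N g.
    apply: eq_iter_span (iter_spanI i (iter_span1 a)) => x.
    rewrite (_ : (fun s => _) = laurent N h); first by rewrite gE hN mul0r add0r.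
    by apply/funext => s; rewrite mulr1 aE.
  have [p pE] := uj _ _ Wg; exists p => x.
  by rewrite aE gE hN mul0r add0r; apply: pE; exact: expi_neq0.
have [p pP] := choice ex; exists (laurent j u), p; split=> //.
by apply/trig_polyP; exists j, u.
Qed.

End IsotropicLaurent.

(** * Coefficients of the fundamental solution *)

Section PicardWords.
Variables (R : realType) (n : nat) (a : 'I_n -> R -> R[i]).
Hypothesis ca : forall i, ccont (a i).
Implicit Types (L : seq 'I_n).
Local Notation A := (malg (fmonom 'I_2) R[i]).

(** Letter 0 is [X1] and letter 1 is [X2]. *)
Fixpoint wmon L : seq 'I_2 :=
  if L is i :: L' then 0 :: nseq i 1 ++ wmon L' else [::].

Definition word L : A := mkmalgU (FMonom (wmon L)) 1.

(** The power of t accompanying the word: in [omega], index i comes with t^(i + 1). *)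
Definition weight L : nat := sumn [seq (nat_of_ord i).+1 | i <- L].

Fixpoint words k : seq (seq 'I_n) :=
  if k is k'.+1 then [seq i :: L | i <- enum 'I_n, L <- words k'] else [:: [::]].

(** Each block starts with the letter 0, so the blocks can be read off the word. *)
Lemma wmon_inj : injective wmon.
Proof.
have ne01 (s s' : seq 'I_2) : 1 :: s <> 0 :: s' 
  by move=> e; have := congr1 (fun l : seq 'I_2 => nat_of_ord (head 0 l)) e.
have nE (i j : nat) (s s' : seq 'I_2) : nseq i 1 ++ s = nseq j 1 ++ s' ->
    (s = [::] \/ exists r, s = 0 :: r) -> (s' = [::] \/ exists r, s' = 0 :: r) ->
    i = j /\ s = s'.
  elim: i j => [|i IH] [|j] //=.
  - by move=> -> [//|[r /ne01]].
  - by move=> <- _ [//|[r /ne01]].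
  by move=> [e] p p'; have [-> ->] := IH _ e p p'.
have w0 L : wmon L = [::] \/ exists r, wmon L = 0 :: r.
  by case: L => [|i L]; [left|right; eexists].
elim=> [|i L IH] [|j L'] //= [e]; have [ij /IH ->] := nE _ _ _ _ e (w0 _) (w0 _).
by congr (_ :: _); exact: val_inj.
Qed.

Lemma mcoeff_word L L' : mcoeff (FMonom (wmon L)) (word L') = (L == L')%:R.
Proof. by rewrite mcoeffU fmP /= (inj_eq wmon_inj) eq_sym. Qed.

Lemma mulUU (s s' : seq 'I_2) :
  mkmalgU (FMonom s) 1 * mkmalgU (FMonom s') 1 = mkmalgU (FMonom (s ++ s')) 1 :> A.
Proof.
rewrite malgM_def fgmulUU mulr1; congr (mkmalgU _ _); exact: fmmulE.
Qed.

Lemma word_cons (i : 'I_n) L : X1 R * X2 R ^+ i * word L = word (i :: L).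
Proof.
have X2E k : X2 R ^+ k = mkmalgU (FMonom (nseq k 1)) 1.
  elim: k => [|k IH]; first by rewrite expr0 -fmoneE.
  by rewrite exprS IH /X2 fmuE mulUU.
by rewrite X2E /X1 fmuE !mulUU.
Qed.

Lemma size_words k L : L \in words k -> size L = k.
Proof.
elim: k L => [|k IH] L /=; first by rewrite inE => /eqP ->.
by move=> /allpairsP[[i L'] /= [_ /IH <- ->]].
Qed.

Lemma mem_words L : L \in words (size L).
Proof.
elim: L => [|i L IH] //=; apply/allpairsP; exists (i, L) => /=.
by rewrite mem_enum.
Qed.

Lemma words_uniq k : uniq (words k).
Proof.
elim: k => [|k IH] //=; apply: allpairs_uniq => //; first exact: enum_uniq.
by move=> [i L] [i' L'] _ _ /= [-> ->].
Qed.

Lemma size_weight L : (size L <= weight L)%N.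
Proof.
elim: L => [|i L IH] //=.
by rewrite /weight /= addSn ltnS (leq_trans IH) ?leq_addl.
Qed.

Lemma tmonomM (u v : A) d e : tmonom u d * tmonom v e = tmonom (u * v) (d + e).
Proof.
apply: fpsP => m; rewrite fcoefM /=; have [dm|md] := leqP d m.
  rewrite (bigD1 (Ordinal (dm : (d < m.+1)%N))) //= eqxx big1 ?addr0.
    by rewrite -(eqn_add2l d) subnKC //; case: ifP; rewrite ?mulr0.
  by move=> i /negPf; rewrite -val_eqE /= => ->; rewrite mul0r.
rewrite big1 => [|[i /= im] _]; first by rewrite ltn_eqF // (leq_trans md) ?leq_addr.
by rewrite ltn_eqF ?mul0r // (leq_trans _ md).
Qed.

(** The derivative of [iint a L], hence 0 on the empty word. *)
Let wcoef L (s : R) : R[i] := if L is i :: L' then a i s * iint a L' s else 0.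

Lemma iint_cont L : ccont (iint a L).
Proof.
elim: L => [|i L IH]; first exact: ccont_cst.
by apply: cderiv_ccont; apply: cderiv_iint.
Qed.

(** Multiplying by [omega] and integrating prepends one letter, so the k-th iterate collects the
    words of length k. *)
Lemma picardE k x :
  picard a k x = \sum_(L <- words k) tmonom (iint a L x *: word L) (weight L).
Proof.
elim: k x => [|k IH] x.
  rewrite big_seq1 /= scale1r; apply: fpsP => d /=.
  by rewrite /word /= -fmoneE; case: eqP.
have oE s : omega a s * picard a k s =
    \sum_(L <- words k.+1) tmonom (wcoef L s *: word L) (weight L).
  rewrite IH /omega mulr_suml /= big_allpairs_dep big_enum /=; apply: eq_big => // i _.
  rewrite mulr_sumr; apply: eq_bigr => L _.
  by rewrite tmonomM -scalerAl malg_scalerAr scalerA word_cons.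
apply: fpsP => d.
have -> : (picard a k.+1 x).[t^d] =
    aint (fun s => (omega a s * picard a k s).[t^d]) 0 x by [].
have wE L : L \in words k.+1 -> cint (wcoef L) 0 x = iint a L x.
  by move/size_words; case: L.
have cw L : ccont (wcoef L).
  case: L => [|l L] /=; first exact: ccont_cst.
  by apply: ccontM => //; exact: iint_cont.
pose T := in_tuple (words k.+1).
pose u (i : 'I_(size T)) : A := if d == weight (tnth T i) then word (tnth T i) else 0.
rewrite (@aintE _ _ (fun i => wcoef (tnth T i)) u).
- rewrite fcoef_sum [RHS]big_tnth; apply: eq_bigr => i _ /=.
  rewrite /u /=; case: ifP => _; last by rewrite scaler0.
  by rewrite wE //; exact: (mem_tnth i T).
- by move=> i; exact: cw.
move=> s; rewrite oE fcoef_sum [LHS]big_tnth; apply: eq_bigr => i _ /=.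
by rewrite /u; case: ifP => // _; rewrite scaler0.
Qed.

(** Only the iterate of index [size L] contains the word of [L], and the truncated sum includes it
    because size L <= weight L. *)
Lemma mcoeff_fundsol L x :
  mcoeff (FMonom (wmon L)) (fundsol a x).[t^(weight L)] = iint a L x.
Proof.
rewrite raddf_sum /=.
have sw : (size L < (weight L).+1)%N by rewrite ltnS size_weight.
rewrite (bigD1 (Ordinal sw)) //= big1 ?addr0 => [|k /negPf kL].
  rewrite picardE fcoef_sum raddf_sum (bigD1_seq L) ?mem_words ?words_uniq //=.
  rewrite eqxx mcoeffZ mcoeff_word eqxx mulr1 big1 ?addr0 // => L' /negPf LL'.
  by case: ifP => _; rewrite ?mcoeff0 // mcoeffZ mcoeff_word eq_sym LL' mulr0.
rewrite picardE fcoef_sum raddf_sum big_seq big1 // => L' /size_words sL'.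
rewrite /=; case: ifP => _; rewrite ?mcoeff0 // mcoeffZ mcoeff_word.
case: eqP => [LL'|]; last by rewrite mulr0.
by rewrite -val_eqE /= -sL' LL' eqxx in kL.
Qed.

Lemma fundsol_trivial x :
  fundsol a x = 1 <-> forall L, L != [::] -> iint a L x = 0.
Proof.
split=> [F1 L L0|H].
  rewrite -mcoeff_fundsol F1 fcoef1; case: L L0 => // i L _.
  by rewrite mcoeff0.
apply: fpsP => d; rewrite [LHS]big_ord_recl /= big1 ?addr0 // => k _.
rewrite [LHS](congr1 (fun f : fps A => f.[t^d]) (picardE k.+1 x)) fcoef_sum big_seq big1 //.
move=> L /size_words sL /=; rewrite H ?scale0r; first by case: ifP.
by rewrite -size_eq0 sL.
Qed.

End PicardWords.

(** * Iterated integrals of composite coefficients, and the equivalence *)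

Lemma poly_primitive (C : numClosedFieldType) (p : {poly C}) : exists P, P^`() = p.
Proof.
exists (\poly_(i < (size p).+1) (p`_i.-1 / i%:R)); apply/polyP => i.
rewrite coef_deriv coef_poly /= ltnS; case: ltnP => pi.
  by rewrite -[_ *+ _]mulr_natr divfK // pnatr_eq0.
by rewrite nth_default ?mul0rn.
Qed.

(** Since a_i = p_i'(q) q', the integrand is (p_i' P)(q) q', the derivative of Q(q) for a primitive
    Q of p_i' P. *)
Lemma iint_composite (R : realType) n (a : 'I_n -> R -> R[i]) q
    (p : 'I_n -> {poly R[i]}) :
  (forall i, trig_poly (a i)) -> trig_poly q ->
  (forall i x, cint (a i) 0 x = (p i).[q x]) ->
  forall L, exists P : {poly R[i]}, iint a L =1 fun x => P.[q x].
Proof.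
move=> ta /trig_polyP[N [h qE]] aE.
have ca i : ccont (a i) by exact: trig_poly_cont.
have dq : cderiv q (laurent N ('i%C *: ('X * h^`() - h *+ N))).
  by rewrite qE; exact: cderiv_laurent.
set q' := laurent _ _ in dq.
have aE' i : a i =1 fun x => (p i)^`().[q x] * q' x.
  apply: cderiv_inj (cint_cderiv 0 (ca i)) _.
  by apply: eq_cderiv (cderiv_horner (p i) dq) => // x; exact: aE.
elim=> [|i L [P PE]]; first by exists 1 => x; rewrite hornerC.
have [Q QE] := poly_primitive ((p i)^`() * P); exists (Q - Q.[q 0]%:P) => x /=.
have d : cderiv (fun x => Q.[q x]) (fun s => a i s * iint a L s).
  apply: eq_cderiv (cderiv_horner Q dq) => // y.
  by rewrite aE' PE QE hornerM; ring.
rewrite (cint_uniq 0 x _ d) ?hornerD ?hornerN ?hornerC //.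
by apply: ccontM => //; exact: iint_cont.
Qed.

Theorem corollary2p17 (R : realType) (n : nat) (a : 'I_n -> R -> R[i]) :
  (1 <= n)%N ->
  (forall i : 'I_n, trig_poly (a i)) ->
  ((forall m : int, monodromy a m = 1) <->
   (exists (q : R -> R[i]) (p : 'I_n -> {poly R[i]}),
      trig_poly q /\
      forall (i : 'I_n) (x : R), cint (a i) 0 x = (p i).[q x])).
Proof.
move=> _ ta; have ca i : ccont (a i) by exact: trig_poly_cont.
split=> [mono1|[q [p [tq aE]]] m].
  apply: iint_trivial_composite ta _; apply/(fundsol_trivial ca).
  by have := mono1 1; rewrite /monodromy mulr1.
apply/(fundsol_trivial ca) => -[|i L] // _.
have [P PE] := iint_composite ta tq aE (i :: L).
(* As q is periodic, P(q) takes the same value at 2 pi m as at 0, where the integral is 0. *)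
rewrite PE -[2 * pi * _]add0r trig_poly_periodic_int // -PE.
exact: cint_id.
Qed.
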